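(* Let $V_h:\mathbb{R}^2\times\mathbb{R}\to\mathbb{R}$, $h>0$, be the explicit function defined in the context. Then $$V_h(x,y,t)=O(h^{-1/2}),\qquad h\to0,$$ locally uniformly in $(x,y,t)$; that is, for every compact set $K\subset\mathbb{R}^2\times\mathbb{R}$ there exist constants $C>0$ and $h_0>0$ such that $|V_h(x,y,t)|\leqslant C\,h^{-1/2}$ for all $(x,y,t)\in K$ and all $0<h<h_0$.
   Context: Definition of $V_h$. Let $h>0$. For real $x,y,t$ with $y\geqslant|t|$ put $$w_h(x,y,t)=\frac{1}{4\pi^{3/2}\sqrt h}\int_{-\pi}^{\pi}\exp\left(-\frac1h\left(x-i\sqrt{y^2-t^2}\,\sin s\right)^2\right)ds .$$ For $(x,y,t)\in\mathbb{R}^3$ put $$v_h(x,y,t)=-\theta(y-|t|)\,w_h(x,y,t),$$ where $\theta$ is the Heaviside function; thus $v_h=0$ if $y<|t|$ (the value chosen for $\theta(0)$ plays no role). For $\alpha\in[-\pi,\pi]$ put $$v_h^\alpha(x,y,t)=v_h(x\cos\alpha+y\sin\alpha,\,-x\sin\alpha+y\cos\alpha,\,t),$$ and define $$V_h(x,y,t)=\frac1{2\pi}\int_{-\pi}^{\pi}v_h^\alpha(x,y,t)\,d\alpha .$$ *)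

(* Defs.v *)
From Stdlib Require Import Reals Lra List.
From Coquelicot Require Import Coquelicot.
Open Scope R_scope.

Definition Cexp (z : C) : C :=
  (exp (Re z) * cos (Im z), exp (Re z) * sin (Im z)).

(* The value at 0 is left as a parameter, since it is a matter of convention. *)
Definition heaviside (theta0 z : R) : R :=
  match total_order_T z 0 with
  | inleft (left _) => 0
  | inleft (right _) => theta0
  | inright _ => 1
  end.

(* Only meaningful for [Rabs t <= y]; elsewhere it is multiplied by 0 in [v]. *)
Definition w_integrand (h x y t s : R) : C :=
  Cexp (- (RtoC (1 / h) * (RtoC x - Ci * RtoC (sqrt (y ^ 2 - t ^ 2)) * RtoC (sin s)) ^ 2))%C.

(* The complex integral is real, see [w_integral_Im], so [Re] discards nothing. *)
Definition w (h x y t : R) : R :=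
  1 / (4 * Rpower PI (3 / 2) * sqrt h)
  * Re (RInt (V := C_R_CompleteNormedModule) (w_integrand h x y t) (- PI) PI).

Definition v (theta0 h x y t : R) : R :=
  - heaviside theta0 (y - Rabs t) * w h x y t.

Definition v_rot (theta0 alpha h x y t : R) : R :=
  v theta0 h (x * cos alpha + y * sin alpha) (- x * sin alpha + y * cos alpha) t.

(* For fixed [h], [x], [y], [t] the integrand is bounded and has at most finitely
   many discontinuities (where [- x * sin alpha + y * cos alpha = Rabs t]), so
   this is a genuine Riemann integral. *)
Definition V (theta0 h x y t : R) : R :=
  1 / (2 * PI) * RInt (fun alpha => v_rot theta0 alpha h x y t) (- PI) PI.

Definition compact_set {T : UniformSpace} (K : T -> Prop) : Prop :=
  forall F : (T -> Prop) -> Prop,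
    (forall U, F U -> open U) ->
    (forall p, K p -> exists U, F U /\ U p) ->
    exists l : list (T -> Prop),
      (forall U, In U l -> F U) /\
      (forall p, K p -> exists U, In U l /\ U p).

Lemma w_integrand_eq (h x y t s : R) :
  let r := sqrt (y ^ 2 - t ^ 2) in
  w_integrand h x y t s =
    (exp ((r ^ 2 * sin s ^ 2 - x ^ 2) * / h) * cos (2 * x * r * sin s * / h),
     exp ((r ^ 2 * sin s ^ 2 - x ^ 2) * / h) * sin (2 * x * r * sin s * / h)).
Proof.
intros r; unfold w_integrand, Cexp; fold r.
replace (- (RtoC (1 / h) * (RtoC x - Ci * RtoC r * RtoC (sin s)) ^ 2))%C
  with ((r ^ 2 * sin s ^ 2 - x ^ 2) * / h, 2 * x * r * sin s * / h); [reflexivity|].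
unfold Rdiv, Ci, RtoC, Cminus, Copp, Cplus, Cmult; simpl; unfold Cmult; simpl.
apply injective_projections; simpl; ring.
Qed.

Lemma w_integral_pair (h x y t : R) :
  exists a : R,
    is_RInt (V := C_R_CompleteNormedModule) (w_integrand h x y t) (- PI) PI (a, 0).
Proof.
set (r := sqrt (y ^ 2 - t ^ 2)).
set (f := fun s => exp ((r ^ 2 * sin s ^ 2 - x ^ 2) * / h) * cos (2 * x * r * sin s * / h)).
set (g := fun s => exp ((r ^ 2 * sin s ^ 2 - x ^ 2) * / h) * sin (2 * x * r * sin s * / h)).
assert (Hf : ex_RInt f (- PI) PI).
{ apply (ex_RInt_continuous (V := R_CompleteNormedModule)); intros z _.
  apply (ex_derive_continuous (V := R_NormedModule)); unfold f; auto_derive; easy. }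
assert (Hg : ex_RInt g (- PI) PI).
{ apply (ex_RInt_continuous (V := R_CompleteNormedModule)); intros z _.
  apply (ex_derive_continuous (V := R_NormedModule)); unfold g; auto_derive; easy. }
destruct Hf as [a Ha]; destruct Hg as [b Hb].
assert (Hb' : is_RInt g (- PI) PI (- b)).
{ assert (H1 : is_RInt g (- - PI) (- PI) (- b)).
  { rewrite Ropp_involutive; exact (is_RInt_swap _ _ _ _ Hb). }
  apply is_RInt_comp_opp in H1.
  apply is_RInt_ext with (2 := H1).
  intros s _; unfold g, opp; simpl; rewrite sin_neg.
  replace (2 * x * r * - sin s * / h) with (- (2 * x * r * sin s * / h)) by ring.
  rewrite sin_neg.
  replace (r * (r * 1) * (- sin s * (- sin s * 1))) with (r * (r * 1) * (sin s * (sin s * 1))) by ring.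
  ring. }
assert (b = 0).
{ assert (E : b = - b) by
    (rewrite <- (is_RInt_unique _ _ _ _ Hb) at 1; exact (is_RInt_unique _ _ _ _ Hb')).
  lra. }
subst b; exists a.
apply (is_RInt_ext (V := C_R_NormedModule) (fun s => (f s, g s))).
{ intros s _; symmetry; exact (w_integrand_eq h x y t s). }
exact (is_RInt_fct_extend_pair (U := R_NormedModule) (V := R_NormedModule)
         (fun s => (f s, g s)) (- PI) PI a 0 Ha Hb).
Qed.

Lemma w_integral_ex (h x y t : R) :
  ex_RInt (V := C_R_CompleteNormedModule) (w_integrand h x y t) (- PI) PI.
Proof. destruct (w_integral_pair h x y t) as [a Ha]; exists (a, 0); exact Ha. Qed.

Lemma w_integral_Im (h x y t : R) :
  Im (RInt (V := C_R_CompleteNormedModule) (w_integrand h x y t) (- PI) PI) = 0.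
Proof.
destruct (w_integral_pair h x y t) as [a Ha].
rewrite (is_RInt_unique _ _ _ _ Ha); reflexivity.
Qed.

(* Main.v *)
Require Import Defs.
From Stdlib Require Import Reals Lra Lia Factorial.
From Coquelicot Require Import Coquelicot.
Open Scope R_scope.

(* Write (x, y) in polar coordinates with radius rho and |t| = rho cos p. After the
   rotation the argument of the Gaussian is R Z with R = rho sin p,
   Z = u - i sqrt (1 - u^2) sin s and u = sin phi / sin p, |phi| < p. By Laplace's formula
   the mean of Z^m over s is the Legendre polynomial P_m(u), so 2 pi sqrt h V is, up to a
   constant, the integral over |phi| < p of sum_n (- R^2 / h)^n / n! P_(2n)(u).
   In the variable u the measure d phi is an average over b of the kernels
   kappa / (1 - k u) du, k = kappa cos b, kappa = sin p (Poisson), and by Neumann's formula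
   the integral of P_m(u) / (1 - k u) is that of xi^m / (1 - k u) with xi = xi(k, u) in [-1, 1].
   Hence the whole sum is the integral of exp (- R^2 xi^2 / h) <= 1 against a positive
   measure of mass 2 p, which removes the exponentially large terms and leaves h^(-1/2). *)

(* Equations produced by Coquelicot live in a carrier that [ring] does not recognise as [R]. *)
Ltac eqR := match goal with |- @eq _ ?a ?b => change (@eq R a b) end.

(** For [y > |t|] the integrand of [w] has modulus [exp ((r ^ 2 * sin s ^ 2 - x ^ 2) / h)] with
    [r ^ 2 = y ^ 2 - t ^ 2], exponentially large where [|r sin s| > |x|], and termwise bounds of its
    power series lose just as much. The estimate rests on cancellation in the rotation average,
    which absolute values destroy. Positivity captures it: for fixed [p], the linear map that sends
    [sum c_n x^(2n)] to the integral of [sum c_n P_(2n)(sin phi / sin p)] over [|phi| < p] takes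
    polynomials nonnegative on [[-1, 1]] to nonnegative numbers. Applied to [A + f] and [A - f], it
    bounds the image of [f] by [2 p A], however large the coefficients of [f] are. This is run on
    truncated series: the truncation rank depends on [h], the bound on the partial sums does not.
    The kernels [1 / (1 - k u)] serve as weights because against them Bonnet's recurrence becomes a
    recurrence between integrals that the powers of [xi] also satisfy. The weight of [d phi] becomes
    unbounded when [p = PI / 2], that is for [t = 0]; this cap is reached by continuity in [p]. *)

Lemma is_RInt_Rplus (f g : R -> R) (a b lf lg : R) :
  is_RInt f a b lf -> is_RInt g a b lg -> is_RInt (fun x => f x + g x) a b (lf + lg).
Proof. exact (is_RInt_plus (V := R_NormedModule) f g a b lf lg). Qed.

Lemma is_RInt_Rmult (f : R -> R) (c a b l : R) :
  is_RInt f a b l -> is_RInt (fun x => c * f x) a b (c * l).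
Proof. exact (is_RInt_scal (V := R_NormedModule) f a b c l). Qed.

Lemma is_RInt_Rconst (c a b : R) : is_RInt (fun _ => c) a b ((b - a) * c).
Proof. exact (is_RInt_const (V := R_NormedModule) a b c). Qed.

Lemma is_RInt_sum_f_R0 (f : nat -> R -> R) (a b : R) (l : nat -> R) (N : nat) :
  (forall n, is_RInt (f n) a b (l n)) ->
  is_RInt (fun x => sum_f_R0 (fun n => f n x) N) a b (sum_f_R0 l N).
Proof.
intros H; induction N as [|N IH]; simpl; [apply H|].
apply is_RInt_Rplus; [exact IH | apply H].
Qed.

Lemma is_RInt_FTC (F f : R -> R) (a b : R) : a <= b ->
  (forall x, a <= x <= b -> is_derive F x (f x)) ->
  (forall x, a <= x <= b -> ex_derive f x) -> is_RInt f a b (F b - F a).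
Proof.
intros Hab HF Hf.
apply (is_RInt_derive (V := R_CompleteNormedModule) F f);
  rewrite Rmin_left, Rmax_right by lra; [exact HF|].
intros x Hx; apply (ex_derive_continuous (V := R_NormedModule)), Hf, Hx.
Qed.

Lemma ex_RInt_ex_derive (f : R -> R) (a b : R) : a <= b ->
  (forall x, a <= x <= b -> ex_derive f x) -> ex_RInt f a b.
Proof.
intros Hab H; apply (ex_RInt_continuous (V := R_CompleteNormedModule)).
rewrite Rmin_left, Rmax_right by lra.
intros x Hx; apply (ex_derive_continuous (V := R_NormedModule)), H, Hx.
Qed.

Lemma is_RInt_abs_bound (f : R -> R) (a b l M : R) : a <= b -> is_RInt f a b l ->
  (forall x, a <= x <= b -> Rabs (f x) <= M) -> Rabs l <= (b - a) * M.
Proof.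
intros Hab Hf HM; rewrite <- (is_RInt_unique (V := R_CompleteNormedModule) _ _ _ _ Hf).
apply abs_RInt_le_const; [exact Hab | now exists l | exact HM].
Qed.

Lemma is_RInt_zero (f : R -> R) (a b : R) : a <= b ->
  (forall x, a < x < b -> f x = 0) -> is_RInt f a b 0.
Proof.
intros Hab H; apply (is_RInt_ext (fun _ => 0)).
- rewrite Rmin_left, Rmax_right by exact Hab; intros x Hx; symmetry; now apply H.
- assert (Z := is_RInt_Rconst 0 a b); rewrite Rmult_0_r in Z; exact Z.
Qed.

Lemma is_RInt_shift_period (g : R -> R) (d l : R) : 0 <= d <= 2 * PI ->
  (forall x, g (x + 2 * PI) = g x) -> is_RInt g (- PI) PI l ->
  is_RInt (fun x => g (x + d)) (- PI) PI l.
Proof.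
intros Hd Per Hg; assert (Hpi := PI_RGT_0).
assert (Tr : forall e a b m, is_RInt g (a + e) (b + e) m -> is_RInt (fun x => g (x + e)) a b m).
{ intros e a b m H.
  replace (a + e) with (1 * a + e) in H by ring; replace (b + e) with (1 * b + e) in H by ring.
  apply (is_RInt_comp_lin (V := R_NormedModule)) in H.
  apply is_RInt_ext with (2 := H); intros x _.
  change (1 * g (1 * x + e) = g (x + e)); now rewrite !Rmult_1_l. }
assert (E1 : ex_RInt g (- PI) (- PI + d))
  by (apply (ex_RInt_Chasles_1 (V := R_CompleteNormedModule)) with PI; [lra | now exists l]).
assert (E2 : ex_RInt g (- PI + d) PI)
  by (apply (ex_RInt_Chasles_2 (V := R_CompleteNormedModule)) with (- PI); [lra | now exists l]).
destruct E1 as [l1 H1]; destruct E2 as [l2 H2].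
assert (H12 := is_RInt_Chasles (V := R_NormedModule) _ _ _ _ _ _ H1 H2).
apply (is_RInt_unique (V := R_CompleteNormedModule)) in H12.
apply (is_RInt_unique (V := R_CompleteNormedModule)) in Hg.
assert (El : l = l2 + l1) by (rewrite <- Hg, H12; apply Rplus_comm).
apply Tr; rewrite El.
apply (is_RInt_Chasles (V := R_NormedModule)) with PI; [exact H2|].
(* The part of the shifted interval beyond [PI] is the initial piece [[- PI, - PI + d]] moved by one
   period. *)
assert (H3 : is_RInt g (PI + - (2 * PI)) (PI + d + - (2 * PI)) l1)
  by (replace (PI + - (2 * PI)) with (- PI) by ring;
      replace (PI + d + - (2 * PI)) with (- PI + d) by ring; exact H1).
apply Tr in H3; apply is_RInt_ext with (2 := H3).
intros x _; rewrite <- Per; f_equal; ring.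
Qed.

(** * The exponential series along a ray *)

Lemma Cpow_Re_Im_S (p q : R) (n : nat) :
  Re ((p, q) ^ S n)%C = p * Re ((p, q) ^ n)%C - q * Im ((p, q) ^ n)%C /\
  Im ((p, q) ^ S n)%C = p * Im ((p, q) ^ n)%C + q * Re ((p, q) ^ n)%C.
Proof. rewrite Cpow_S; split; unfold Cmult, Re, Im; simpl; ring. Qed.

(** The left-hand side is the real part of [w] times the unit number [exp (i x)]; the square
    introduced below is that of the imaginary part. *)
Lemma Re_rotation_bound (w : C) (x : R) : Rabs (Re w * cos x - Im w * sin x) <= Cmod w.
Proof.
unfold Cmod, Re, Im; rewrite <- (sqrt_Rsqr_abs); apply sqrt_le_1_alt.
assert (H := sin2_cos2 x); unfold Rsqr in *.
set (a := fst w); set (b := snd w).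
assert (0 <= (a * sin x + b * cos x) ^ 2) by apply pow2_ge_0.
assert (a ^ 2 + b ^ 2 = (a ^ 2 + b ^ 2) * (sin x * sin x + cos x * cos x)) by (rewrite H; ring).
nra.
Qed.

(** The function is [Re (exp (l z))], so each derivative multiplies by [z] under the real part.
    Restricting to a ray makes the real Taylor-Lagrange formula available for the complex
    exponential. *)
Lemma Cexp_ray_derive_n (z : C) (n : nat) (l : R) :
  is_derive_n (fun l => exp (l * Re z) * cos (l * Im z)) n l
    (exp (l * Re z) * (Re (z ^ n)%C * cos (l * Im z) - Im (z ^ n)%C * sin (l * Im z))).
Proof.
revert l; induction n as [|n IH]; intros l.
{ change (exp (l * Re z) * cos (l * Im z)
    = exp (l * Re z) * (1 * cos (l * Im z) - 0 * sin (l * Im z))); ring. }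
simpl.
apply (is_derive_ext
  (fun l => exp (l * Re z) * (Re (z ^ n)%C * cos (l * Im z) - Im (z ^ n)%C * sin (l * Im z)))).
{ intros t; symmetry; apply is_derive_n_unique, IH. }
destruct z as [p q]; destruct (Cpow_Re_Im_S p q n) as [H1 H2].
change (is_derive (fun l => exp (l * p) * (Re ((p, q) ^ n)%C * cos (l * q) - Im ((p, q) ^ n)%C * sin (l * q))) l
  (exp (l * p) * (Re ((p, q) ^ S n)%C * cos (l * q) - Im ((p, q) ^ S n)%C * sin (l * q)))).
rewrite H1, H2.
auto_derive; [easy | ring].
Qed.

Lemma Re_Cexp_taylor (z : C) (n : nat) :
  Rabs (Re (Cexp z) - sum_f_R0 (fun k => / INR (fact k) * Re (z ^ k)%C) n)
  <= exp (Cmod z) * (Cmod z ^ S n / INR (fact (S n))).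
Proof.
destruct (Taylor_Lagrange (fun l => exp (l * Re z) * cos (l * Im z)) n 0 1) as [t [Ht E]].
{ lra. }
{ intros t _ k _; destruct k; [exact I|].
  eexists; exact (Cexp_ray_derive_n z (S k) t). }
replace (Re (Cexp z)) with (exp (1 * Re z) * cos (1 * Im z))
  by (unfold Cexp, Re at 1; simpl; now rewrite !Rmult_1_l).
rewrite E, (is_derive_n_unique _ _ _ _ (Cexp_ray_derive_n z (S n) t)).
rewrite (sum_eq _ (fun k => / INR (fact k) * Re (z ^ k)%C)).
2:{ intros k _; rewrite (is_derive_n_unique _ _ _ _ (Cexp_ray_derive_n z k 0)).
    rewrite !Rmult_0_l, exp_0, cos_0, sin_0, Rminus_0_r, pow1; unfold Rdiv; ring. }
match goal with |- Rabs (?s + ?r - ?s) <= _ => replace (s + r - s) with r by ring end.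
rewrite Rminus_0_r, pow1, <- Cmod_pow.
assert (F : 0 < / INR (fact (S n))) by apply Rinv_0_lt_compat, INR_fact_lt_0.
rewrite Rabs_mult, (Rabs_pos_eq (1 / _)) by lra.
rewrite Rabs_mult, (Rabs_pos_eq (exp _)) by apply Rlt_le, exp_pos.
replace (1 / INR (fact (S n))) with (/ INR (fact (S n))) by (unfold Rdiv; ring).
replace (exp (Cmod z) * (Cmod (z ^ S n)%C / INR (fact (S n))))
  with (/ INR (fact (S n)) * (exp (Cmod z) * Cmod (z ^ S n)%C)) by (unfold Rdiv; ring).
apply Rmult_le_compat_l; [lra|].
apply Rmult_le_compat.
- apply Rlt_le, exp_pos.
- apply Rabs_pos.
- assert (G : t * Re z <= Cmod z).
  { assert (B := Rmax_Cmod z); assert (P := Cmod_ge_0 z).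
    assert (Rabs (Re z) <= Cmod z) by (eapply Rle_trans; [apply Rmax_l | exact B]).
    assert (Re z <= Rabs (Re z)) by apply Rle_abs.
    destruct (Rle_dec 0 (Re z)); nra. }
  destruct G as [G|G]; [apply Rlt_le, exp_increasing, G | rewrite G; lra].
- apply Re_rotation_bound.
Qed.

Lemma exp_tail_small (M eps : R) : 0 <= M -> 0 < eps ->
  exists N, forall n, (N <= n)%nat -> exp M * (M ^ S n / INR (fact (S n))) < eps.
Proof.
intros HM He.
destruct (cv_speed_pow_fact M (eps / exp M)) as [N HN].
{ apply Rdiv_lt_0_compat; [exact He | apply exp_pos]. }
exists N; intros n Hn.
specialize (HN (S n) ltac:(lia)); unfold R_dist in HN; rewrite Rminus_0_r in HN.
assert (A := Rle_abs (M ^ S n / INR (fact (S n)))).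
assert (P := exp_pos M).
apply Rle_lt_trans with (exp M * Rabs (M ^ S n / INR (fact (S n)))); [nra|].
replace eps with (exp M * (eps / exp M)) by (field; lra).
apply Rmult_lt_compat_l; lra.
Qed.

Lemma Re_Cexp_taylor_uniform (M eps : R) : 0 <= M -> 0 < eps ->
  exists N, forall n z, (N <= n)%nat -> Cmod z <= M ->
    Rabs (Re (Cexp z) - sum_f_R0 (fun k => / INR (fact k) * Re (z ^ k)%C) n) < eps.
Proof.
intros HM He; destruct (exp_tail_small M eps HM He) as [N HN].
exists N; intros n z Hn Hz.
eapply Rle_lt_trans; [apply Re_Cexp_taylor|].
eapply Rle_lt_trans; [|exact (HN n Hn)].
assert (0 <= Cmod z) by apply Cmod_ge_0.
apply Rmult_le_compat.
- apply Rlt_le, exp_pos.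
- apply Rmult_le_pos; [now apply pow_le | apply Rlt_le, Rinv_0_lt_compat, INR_fact_lt_0].
- destruct Hz as [G|G]; [apply Rlt_le, exp_increasing, G | rewrite G; lra].
- apply Rmult_le_compat_r; [apply Rlt_le, Rinv_0_lt_compat, INR_fact_lt_0|].
  now apply pow_incr.
Qed.

(** * Legendre polynomials *)

Fixpoint legendre (m : nat) (u : R) : R :=
  match m with
  | O => 1
  | S m' =>
    match m' with
    | O => u
    | S m'' =>
      ((2 * INR m' + 1) * u * legendre m' u - INR m' * legendre m'' u) / (INR m' + 1)
    end
  end.

Lemma legendre_bonnet (m : nat) (u : R) :
  (INR m + 2) * legendre (S (S m)) u
  = (2 * INR m + 3) * u * legendre (S m) u - (INR m + 1) * legendre m u.
Proof.
change (legendre (S (S m)) u) with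
 (((2 * INR (S m) + 1) * u * legendre (S m) u - INR (S m) * legendre m u) / (INR (S m) + 1)).
rewrite S_INR; assert (0 <= INR m) by apply pos_INR; field; lra.
Qed.

Lemma nat_pair_ind (P : nat -> Prop) :
  P O -> P 1%nat -> (forall n, P n -> P (S n) -> P (S (S n))) -> forall n, P n.
Proof.
intros H0 H1 H n; enough (P n /\ P (S n)) by tauto.
induction n as [|n [IH1 IH2]]; auto.
Qed.

(** The number [u - i q sin s] of Laplace's integral. [q] stands for [sqrt (1 - u ^ 2)], but is kept
    as a variable so that the algebra uses only [u ^ 2 + q ^ 2 = 1]. *)
Definition laplace_point (u q s : R) : C := (u, - (q * sin s)).

Lemma laplace_point_pow_S (u q s : R) (n : nat) :
  Re (laplace_point u q s ^ S n)%C
    = u * Re (laplace_point u q s ^ n)%C + q * sin s * Im (laplace_point u q s ^ n)%C /\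
  Im (laplace_point u q s ^ S n)%C
    = u * Im (laplace_point u q s ^ n)%C - q * sin s * Re (laplace_point u q s ^ n)%C.
Proof.
unfold laplace_point.
destruct (Cpow_Re_Im_S u (- (q * sin s)) n) as [H1 H2]; rewrite H1, H2; split; ring.
Qed.

(** Real and imaginary parts of [(Z ^ m)' = m Z' Z ^ (m - 1)] with [Z' = - i q cos s]. At [m = 0]
    the truncated [pred] is harmless because of the factor [INR m]. *)
Lemma laplace_point_pow_derive (u q : R) (m : nat) (s : R) :
  is_derive (fun s => Re (laplace_point u q s ^ m)%C) s
    (INR m * (q * cos s) * Im (laplace_point u q s ^ pred m)%C) /\
  is_derive (fun s => Im (laplace_point u q s ^ m)%C) s
    (- (INR m * (q * cos s) * Re (laplace_point u q s ^ pred m)%C)).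
Proof.
induction m as [|m [IH1 IH2]].
{ split; simpl; unfold Re, Im; simpl; auto_derive; [easy | ring | easy | ring]. }
set (c := fun s => Re (laplace_point u q s ^ m)%C) in *.
set (d := fun s => Im (laplace_point u q s ^ m)%C) in *.
assert (E : match m with O => True | S m' =>
  c s = u * Re (laplace_point u q s ^ m')%C + q * sin s * Im (laplace_point u q s ^ m')%C /\
  d s = u * Im (laplace_point u q s ^ m')%C - q * sin s * Re (laplace_point u q s ^ m')%C end).
{ destruct m as [|m']; [easy|].
  destruct (laplace_point_pow_S u q s m') as [H1 H2].
  unfold c, d; rewrite H1, H2; split; ring. }
split.
- apply (is_derive_ext (fun s => u * c s + q * sin s * d s)).
  { intros t; destruct (laplace_point_pow_S u q t m) as [H1 _]; rewrite H1.
    unfold c, d; reflexivity. }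
  auto_derive; [split; [eexists; exact IH1 | split; [eexists; exact IH2 | easy]]|].
  rewrite (is_derive_unique (fun x : R => c x) _ _ IH1), (is_derive_unique (fun x : R => d x) _ _ IH2).
  simpl pred; fold (c s) (d s); rewrite S_INR.
  destruct m as [|m']; [simpl; unfold d; simpl; ring|].
  simpl pred; destruct E as [_ Ed]; rewrite Ed; ring.
- apply (is_derive_ext (fun s => u * d s - q * sin s * c s)).
  { intros t; destruct (laplace_point_pow_S u q t m) as [_ H1]; rewrite H1.
    unfold c, d; eqR; ring. }
  auto_derive; [split; [eexists; exact IH2 | split; [eexists; exact IH1 | easy]]|].
  rewrite (is_derive_unique (fun x : R => c x) _ _ IH1), (is_derive_unique (fun x : R => d x) _ _ IH2).
  simpl pred; fold (c s) (d s); rewrite S_INR.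
  destruct m as [|m']; [simpl; unfold c; simpl; ring|].
  simpl pred; destruct E as [Ec _]; rewrite Ec; ring.
Qed.

(** Bonnet's recurrence passes to the integrals because its defect is the derivative of a function
    with equal values at [- PI] and [PI]. *)
Lemma legendre_laplace (u q : R) (m : nat) : u ^ 2 + q ^ 2 = 1 ->
  is_RInt (fun s => Re (laplace_point u q s ^ m)%C) (- PI) PI (2 * PI * legendre m u).
Proof.
intros Hq; assert (Hpi := PI_RGT_0).
set (c := fun m s => Re (laplace_point u q s ^ m)%C).
set (d := fun m s => Im (laplace_point u q s ^ m)%C).
assert (Dc : forall n s, is_derive (c n) s (INR n * (q * cos s) * d (pred n) s))
  by (intros n s; apply laplace_point_pow_derive).
assert (Dd : forall n s, is_derive (d n) s (- (INR n * (q * cos s) * c (pred n) s)))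
  by (intros n s; apply laplace_point_pow_derive).
assert (cS : forall n s, c (S n) s = u * c n s + q * sin s * d n s).
{ intros n s; destruct (laplace_point_pow_S u q s n) as [H1 _].
  unfold c at 1; rewrite H1; unfold c, d; ring. }
assert (dS : forall n s, d (S n) s = u * d n s - q * sin s * c n s).
{ intros n s; destruct (laplace_point_pow_S u q s n) as [_ H1].
  unfold d at 1; rewrite H1; unfold c, d; ring. }
revert m; apply nat_pair_ind.
- apply is_RInt_ext with (fun _ : R => 1); [intros; reflexivity|].
  replace (2 * PI * legendre 0 u) with ((PI - - PI) * 1) by (simpl; ring).
  apply is_RInt_Rconst.
- replace (2 * PI * legendre 1 u) with
    ((u * PI - q * cos PI * 0) - (u * - PI - q * cos (- PI) * 0)) by (simpl; ring).
  apply (is_RInt_FTC (fun s => u * s - q * cos s * 0)); [lra| |].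
  + intros s _; fold (c 1%nat s); rewrite cS; unfold c, d; simpl.
    auto_derive; [easy | ring].
  + intros s _; eexists; apply (Dc 1%nat).
- intros n IH1 IH2.
  assert (0 <= INR n) by apply pos_INR.
  (* the derivative of Re (cos s * i q * Z^(n+1)), Z = u - i q sin s, is Bonnet's combination of powers of Z *)
  assert (B : is_RInt (fun s => (INR n + 2) * c (S (S n)) s - (2 * INR n + 3) * u * c (S n) s
                 + (INR n + 1) * c n s) (- PI) PI
                (- (q * cos PI * d (S n) PI) - - (q * cos (- PI) * d (S n) (- PI)))).
  { apply (is_RInt_FTC (fun s => - (q * cos s * d (S n) s))); [lra| |].
    - intros s _; assert (D := Dd (S n) s).
      auto_derive; [eexists; exact D|].
      rewrite (is_derive_unique (fun x : R => d (S n) x) _ _ D); simpl pred.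
      rewrite (cS (S n)), dS, cS, S_INR.
      assert (S2 := sin2_cos2 s); unfold Rsqr in S2.
      apply Rminus_diag_uniq.
      transitivity (c n s * (INR n + 1) *
        (q ^ 2 * (sin s * sin s + cos s * cos s - 1) + (u ^ 2 + q ^ 2 - 1))); [ring|].
      rewrite S2, Hq; ring.
    - intros s _; auto_derive; repeat split; eexists; apply Dc. }
  replace (d (S n) (- PI)) with (d (S n) PI) in B
    by (unfold d, laplace_point; rewrite sin_neg, sin_PI; now replace (- 0) with 0 by ring).
  rewrite cos_neg in B.
  assert (B2 := is_RInt_Rmult _ ((2 * INR n + 3) * u) _ _ _ IH2).
  assert (B3 := is_RInt_Rmult _ (- (INR n + 1)) _ _ _ IH1).
  assert (B4 := is_RInt_Rmult _ (/ (INR n + 2)) _ _ _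
                  (is_RInt_Rplus _ _ _ _ _ _ B (is_RInt_Rplus _ _ _ _ _ _ B2 B3))).
  eapply is_RInt_ext; [|replace (2 * PI * legendre (S (S n)) u) with
   (/ (INR n + 2) * (- (q * cos PI * d (S n) PI) - - (q * cos PI * d (S n) PI) +
          ((2 * INR n + 3) * u * (2 * PI * legendre (S n) u) +
           - (INR n + 1) * (2 * PI * legendre n u)))); [exact B4|]].
  + intros s _; simpl; unfold c; simpl; field; lra.
  + assert (L := legendre_bonnet n u).
    apply Rmult_eq_reg_l with (INR n + 2); [|lra].
    rewrite <- Rmult_assoc, Rinv_r, Rmult_1_l by lra.
    replace ((INR n + 2) * (2 * PI * legendre (S (S n)) u))
      with (2 * PI * ((INR n + 2) * legendre (S (S n)) u)) by ring.
    rewrite L; ring.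
Qed.

(** The classical relations between the derivatives of two neighbouring Legendre polynomials. They
    are proved together since each one, at the next index, draws on the previous ones. *)
Lemma legendre_derive_pair (m : nat) (u : R) : exists l0 l1,
  is_derive (legendre m) u l0 /\ is_derive (legendre (S m)) u l1 /\
  l1 = u * l0 + (INR m + 1) * legendre m u /\
  u * l1 = l0 + (INR m + 1) * legendre (S m) u.
Proof.
induction m as [|m [l0 [l1 [D0 [D1 [E1 E2]]]]]].
{ exists 0, 1; split; [|split; [|split]]; simpl; [auto_derive; easy | auto_derive; easy | ring | ring]. }
assert (0 <= INR m) by apply pos_INR.
assert (B := legendre_bonnet m u).
set (l2 := ((2 * INR m + 3) * (legendre (S m) u + u * l1) - (INR m + 1) * l0) / (INR m + 2)).
assert (El2 : (INR m + 2) * l2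
   = (2 * INR m + 3) * (legendre (S m) u + u * l1) - (INR m + 1) * l0)
  by (unfold l2; field; lra).
exists l1, l2; split; [exact D1|]; split; [|split].
- apply (is_derive_ext (fun u =>
    ((2 * INR m + 3) * u * legendre (S m) u - (INR m + 1) * legendre m u) / (INR m + 2))).
  { intros v; assert (Bv := legendre_bonnet m v); rewrite <- Bv; eqR; field; lra. }
  revert D0 D1; unfold l2; generalize (legendre m) (legendre (S m)); intros P0 P1 D0 D1.
  auto_derive.
  { split; [eexists; exact D1 | split; [eexists; exact D0 | easy]]. }
  rewrite (is_derive_unique (fun x : R => P0 x) _ _ D0).
  rewrite (is_derive_unique (fun x : R => P1 x) _ _ D1).
  eqR; field; lra.
- apply Rmult_eq_reg_l with (INR m + 2); [|lra].
  rewrite El2, S_INR.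
  replace l0 with (u * l1 - (INR m + 1) * legendre (S m) u) by lra; ring.
- apply Rmult_eq_reg_l with (INR m + 2); [|lra].
  replace ((INR m + 2) * (u * l2)) with (u * ((INR m + 2) * l2)) by ring.
  rewrite El2, S_INR.
  replace ((INR m + 2) * (l1 + (INR m + 1 + 1) * legendre (S (S m)) u))
    with ((INR m + 2) * l1 + (INR m + 2) * ((INR m + 2) * legendre (S (S m)) u)) by ring.
  rewrite B.
  assert (Q : u * (u * l1) = u * l0 + u * ((INR m + 1) * legendre (S m) u)) by (rewrite E2; ring).
  (* Eliminating [l0] from the two induction hypotheses expresses [(u ^ 2 - 1) P_(m+1)'] through
     [P_(m+1)] and [P_m]. *)
  assert (Q2 : l1 * (u * u - 1) = (INR m + 1) * (u * legendre (S m) u - legendre m u)) by nra.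
  apply Rminus_diag_uniq.
  transitivity ((INR m + 2) * (l1 * (u * u - 1) - (INR m + 1) * (u * legendre (S m) u - legendre m u))
    + (INR m + 1) * u * (u * l1 - (l0 + (INR m + 1) * legendre (S m) u))); [ring|].
  rewrite Q2, E2; ring.
Qed.

Lemma ex_derive_legendre (m : nat) (u : R) : ex_derive (legendre m) u.
Proof. destruct (legendre_derive_pair m u) as [l [_ [H _]]]; now exists l. Qed.

Lemma legendre_at_1 (m : nat) : legendre m 1 = 1.
Proof.
revert m; apply nat_pair_ind; [easy | easy | intros n IH1 IH2].
assert (0 <= INR n) by apply pos_INR.
assert (B := legendre_bonnet n 1); rewrite IH1, IH2 in B.
apply Rmult_eq_reg_l with (INR n + 2); lra.
Qed.

Lemma legendre_at_opp_1 (m : nat) : legendre m (-1) = (-1) ^ m.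
Proof.
revert m; apply nat_pair_ind; [easy | simpl; ring | intros n IH1 IH2].
assert (0 <= INR n) by apply pos_INR.
assert (B := legendre_bonnet n (-1)); rewrite IH1, IH2 in B.
apply Rmult_eq_reg_l with (INR n + 2); [rewrite B; simpl; ring | lra].
Qed.

(** By the second relation of [legendre_derive_pair] the derivative of [u P_(m+1) - P_m] is
    [(m + 2) P_(m+1)], and this primitive vanishes at both endpoints. *)
Lemma legendre_integral (m : nat) : is_RInt (legendre (S m)) (-1) 1 0.
Proof.
assert (0 <= INR m) by apply pos_INR.
set (F := fun u => (u * legendre (S m) u - legendre m u) / (INR m + 2)).
replace 0 with (F 1 - F (-1)).
2:{ unfold F; rewrite !legendre_at_1, !legendre_at_opp_1; simpl; field; lra. }
apply is_RInt_FTC; [lra | | intros; apply ex_derive_legendre].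
intros u _; destruct (legendre_derive_pair m u) as [l0 [l1 [D0 [D1 [E1 E2]]]]].
replace (legendre (S m) u) with ((legendre (S m) u + u * l1 - l0) / (INR m + 2))
  by (rewrite E2; field; lra).
unfold F; clear E1 E2; revert D0 D1; generalize (legendre m) (legendre (S m)); intros P0 P1 D0 D1.
auto_derive.
{ split; [eexists; exact D1 | split; [eexists; exact D0 | easy]]. }
rewrite (is_derive_unique (fun x : R => P0 x) _ _ D0).
rewrite (is_derive_unique (fun x : R => P1 x) _ _ D1).
eqR; field; lra.
Qed.

(** * Neumann's integral *)

(* Rodrigues' formula and [m] integrations by parts give
   [int P_m / (1 - k u) = int (neumann_node k)^m / (1 - k u)] over [-1, 1]; it is proved here by recurrence on [m]. *)
Definition neumann_node (k u : R) : R := k * (1 - u ^ 2) / (2 * (1 - k * u)).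

Lemma one_minus_mult_pos (k u : R) : Rabs k < 1 -> -1 <= u <= 1 -> 0 < 1 - k * u.
Proof. intros Hk Hu; apply Rabs_def2 in Hk; destruct (Rle_dec 0 k); nra. Qed.

Lemma ex_derive_legendre_kernel (k : R) (m : nat) (u : R) : Rabs k < 1 -> -1 <= u <= 1 ->
  ex_derive (fun u => legendre m u / (1 - k * u)) u.
Proof.
intros Hk Hu; assert (P := one_minus_mult_pos k u Hk Hu).
auto_derive; repeat split; [apply ex_derive_legendre | lra].
Qed.

Lemma ex_derive_neumann_kernel (k : R) (m : nat) (u : R) : Rabs k < 1 -> -1 <= u <= 1 ->
  ex_derive (fun u => neumann_node k u ^ m / (1 - k * u)) u.
Proof.
intros Hk Hu; assert (P := one_minus_mult_pos k u Hk Hu).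
unfold neumann_node; auto_derive; repeat split; lra.
Qed.

(** Multiply Bonnet's recurrence by [k / (1 - k u)] and write [k u = 1 - (1 - k u)] in the middle
    term: the only extra term is a multiple of the integral of [P_(m+1)], which is zero. *)
Lemma legendre_kernel_recurrence (k : R) (m : nat) : Rabs k < 1 ->
  let y m := RInt (fun u => legendre m u / (1 - k * u)) (-1) 1 in
  k * (INR m + 2) * y (S (S m)) = (2 * INR m + 3) * y (S m) - k * (INR m + 1) * y m.
Proof.
intros Hk y.
assert (Y : forall n, is_RInt (fun u => legendre n u / (1 - k * u)) (-1) 1 (y n)).
{ intros n; apply (RInt_correct (V := R_CompleteNormedModule)), ex_RInt_ex_derive; [lra|].
  intros u Hu; now apply ex_derive_legendre_kernel. }
assert (A := is_RInt_Rplus _ _ _ _ _ _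
   (is_RInt_Rmult _ (k * (INR m + 2)) _ _ _ (Y (S (S m))))
   (is_RInt_Rplus _ _ _ _ _ _
     (is_RInt_Rmult _ (- (2 * INR m + 3)) _ _ _ (Y (S m)))
     (is_RInt_Rmult _ (k * (INR m + 1)) _ _ _ (Y m)))).
assert (A' := is_RInt_Rmult _ (- (2 * INR m + 3)) _ _ _ (legendre_integral m)).
apply (is_RInt_ext (V := R_NormedModule)) with (g := fun u => - (2 * INR m + 3) * legendre (S m) u) in A.
- apply (is_RInt_unique (V := R_CompleteNormedModule)) in A.
  apply (is_RInt_unique (V := R_CompleteNormedModule)) in A'.
  rewrite A in A'; lra.
- rewrite Rmin_left, Rmax_right by lra; intros u Hu.
  assert (P := one_minus_mult_pos k u Hk ltac:(lra)).
  assert (B := legendre_bonnet m u).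
  apply Rminus_diag_uniq; unfold Rdiv.
  transitivity (k * ((INR m + 2) * legendre (S (S m)) u) * / (1 - k * u)
    + (- (2 * INR m + 3)) * legendre (S m) u * / (1 - k * u)
    + k * (INR m + 1) * legendre m u * / (1 - k * u) + (2 * INR m + 3) * legendre (S m) u); [ring|].
  rewrite B; field; lra.
Qed.

Lemma neumann_kernel_recurrence (k : R) (m : nat) : Rabs k < 1 ->
  let y m := RInt (fun u => neumann_node k u ^ m / (1 - k * u)) (-1) 1 in
  k * (INR m + 2) * y (S (S m)) = (2 * INR m + 3) * y (S m) - k * (INR m + 1) * y m.
Proof.
intros Hk y.
assert (Y : forall n, is_RInt (fun u => neumann_node k u ^ n / (1 - k * u)) (-1) 1 (y n)).
{ intros n; apply (RInt_correct (V := R_CompleteNormedModule)), ex_RInt_ex_derive; [lra|].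
  intros u Hu; now apply ex_derive_neumann_kernel. }
assert (A := is_RInt_Rplus _ _ _ _ _ _
   (is_RInt_Rmult _ (k * (INR m + 2)) _ _ _ (Y (S (S m))))
   (is_RInt_Rplus _ _ _ _ _ _
     (is_RInt_Rmult _ (- (2 * INR m + 3)) _ _ _ (Y (S m)))
     (is_RInt_Rmult _ (k * (INR m + 1)) _ _ _ (Y m)))).
(* [F] is a telescoping certificate of the recurrence; it vanishes at [1] and [-1]. *)
set (F := fun u => - (u - k + k / 2 * (1 - u ^ 2)) / (1 - k * u) * neumann_node k u ^ S m).
set (f := fun u => k * (INR m + 2) * (neumann_node k u ^ S (S m) / (1 - k * u))
   + (- (2 * INR m + 3) * (neumann_node k u ^ S m / (1 - k * u))
      + k * (INR m + 1) * (neumann_node k u ^ m / (1 - k * u)))) in A.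
assert (A' : is_RInt f (-1) 1 (F 1 - F (-1))).
{ apply is_RInt_FTC; [lra | |].
  - intros u Hu; assert (P := one_minus_mult_pos k u Hk Hu).
    assert (D : is_derive (neumann_node k) u
       (- k * u / (1 - k * u) + k ^ 2 * (1 - u ^ 2) / (2 * (1 - k * u) ^ 2))).
    { unfold neumann_node; auto_derive; [lra | eqR; field; lra]. }
    unfold F; auto_derive.
    { repeat split; [lra | eexists; exact D]. }
    rewrite (is_derive_unique (fun x : R => neumann_node k x) _ _ D).
    unfold f; rewrite <- !tech_pow_Rmult.
    change (Init.Nat.pred (S m)) with m; change (match m with O => 1 | S _ => INR m + 1 end) with (INR (S m)); rewrite S_INR.
    set (p := neumann_node k u ^ m); unfold neumann_node; eqR; field; lra.
  - intros u Hu; assert (P := one_minus_mult_pos k u Hk Hu).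
    unfold f, neumann_node; auto_derive; repeat split; lra. }
apply (is_RInt_unique (V := R_CompleteNormedModule)) in A.
apply (is_RInt_unique (V := R_CompleteNormedModule)) in A'.
rewrite A in A'.
replace (F 1 - F (-1)) with 0 in A'
  by (unfold F, neumann_node; rewrite <- !tech_pow_Rmult; unfold Rdiv; ring).
lra.
Qed.

(** The recurrences start only at index two, so [m = 1] is a second initial value. The two
    integrands differ by the derivative of [F], which vanishes at [1] and [-1]. *)
Lemma neumann_kernel_1 (k : R) : Rabs k < 1 ->
  RInt (fun u => legendre 1 u / (1 - k * u)) (-1) 1
  = RInt (fun u => neumann_node k u ^ 1 / (1 - k * u)) (-1) 1.
Proof.
intros Hk.
assert (Y1 : ex_RInt (fun u => legendre 1 u / (1 - k * u)) (-1) 1)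
  by (apply ex_RInt_ex_derive; [lra|]; intros u Hu; now apply ex_derive_legendre_kernel).
apply (RInt_correct (V := R_CompleteNormedModule)) in Y1.
set (F := fun u => - (1 - u ^ 2) / (2 * (1 - k * u))).
assert (D : is_RInt (fun u => u / (1 - k * u) - k * (1 - u ^ 2) / (2 * (1 - k * u) ^ 2))
   (-1) 1 (F 1 - F (-1))).
{ apply is_RInt_FTC; [lra | |]; intros u Hu; assert (P := one_minus_mult_pos k u Hk Hu).
  - unfold F; auto_derive; [lra | eqR; field; lra].
  - auto_derive; repeat split; nra. }
replace (F 1 - F (-1)) with 0 in D by (unfold F, Rdiv; ring).
apply (is_RInt_Rmult _ (-1)) in D.
assert (A := is_RInt_Rplus _ _ _ _ _ _ Y1 D).
apply (is_RInt_ext (V := R_NormedModule)) with (g := fun u => neumann_node k u ^ 1 / (1 - k * u)) in A.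
- apply (is_RInt_unique (V := R_CompleteNormedModule)) in A; rewrite A.
  now rewrite Rmult_0_r, Rplus_0_r.
- rewrite Rmin_left, Rmax_right by lra; intros u Hu.
  assert (P := one_minus_mult_pos k u Hk ltac:(lra)).
  unfold neumann_node; simpl; field; lra.
Qed.

Lemma legendre_neumann (k : R) (m : nat) : Rabs k < 1 ->
  RInt (fun u => legendre m u / (1 - k * u)) (-1) 1
  = RInt (fun u => neumann_node k u ^ m / (1 - k * u)) (-1) 1.
Proof.
intros Hk; destruct (Req_dec k 0) as [->|K].
(* The recurrences carry the factor [k] on their newest term, so [k = 0] is separate; there both
   integrals vanish for positive index. *)
{ destruct m as [|m]; [reflexivity|].
  transitivity 0; [|symmetry]; apply (is_RInt_unique (V := R_CompleteNormedModule)).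
  - apply (is_RInt_ext (legendre (S m))); [|apply legendre_integral].
    intros u _; eqR; field; lra.
  - apply (is_RInt_ext (fun _ : R => 0)).
    + intros u _; unfold neumann_node; simpl; eqR; unfold Rdiv; ring.
    + assert (Z := is_RInt_Rconst 0 (-1) 1); rewrite Rmult_0_r in Z; exact Z. }
revert m; apply nat_pair_ind; [reflexivity | now apply neumann_kernel_1 |].
intros n IH1 IH2; assert (0 <= INR n) by apply pos_INR.
assert (A := legendre_kernel_recurrence k n Hk).
assert (B := neumann_kernel_recurrence k n Hk); cbv beta zeta in A, B.
rewrite IH1, IH2, <- B in A.
apply Rmult_eq_reg_l in A; [exact A|].
apply Rmult_integral_contrapositive; split; lra.
Qed.

(** [|k| (1 - u ^ 2) <= (1 - |u|) (1 + |u|) <= 2 (1 - |u|) <= 2 (1 - k u)]. *)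
Lemma neumann_node_bound (k u : R) : Rabs k < 1 -> -1 <= u <= 1 ->
  -1 <= neumann_node k u <= 1.
Proof.
intros Hk Hu; assert (P := one_minus_mult_pos k u Hk Hu).
apply Rabs_def2 in Hk; unfold neumann_node; split.
- apply Rle_div_r; [lra|]; nra.
- apply Rle_div_l; [lra|]; nra.
Qed.

(** Neumann's formula, applied term by term, turns the Legendre sum into the polynomial of the
    hypothesis evaluated at [neumann_node k u], a point of [[-1, 1]], against the positive weight
    [1 / (1 - k u)]. *)
Lemma legendre_kernel_sum_nonneg (c : nat -> R) (N : nat) (k : R) :
  (forall x, -1 <= x <= 1 -> 0 <= sum_f_R0 (fun n => c n * x ^ (2 * n)) N) ->
  Rabs k < 1 ->
  0 <= RInt (fun u => sum_f_R0 (fun n => c n * legendre (2 * n) u) N / (1 - k * u)) (-1) 1.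
Proof.
intros Hc Hk.
assert (Y : forall n, is_RInt (fun u => c n * (legendre (2 * n) u / (1 - k * u))) (-1) 1
    (c n * RInt (fun u => neumann_node k u ^ (2 * n) / (1 - k * u)) (-1) 1)).
{ intros n; rewrite <- legendre_neumann by exact Hk; apply is_RInt_Rmult.
  apply (RInt_correct (V := R_CompleteNormedModule)), ex_RInt_ex_derive; [lra|].
  intros u Hu; now apply ex_derive_legendre_kernel. }
assert (Z : forall n, is_RInt (fun u => c n * (neumann_node k u ^ (2 * n) / (1 - k * u))) (-1) 1
    (c n * RInt (fun u => neumann_node k u ^ (2 * n) / (1 - k * u)) (-1) 1)).
{ intros n; apply is_RInt_Rmult.
  apply (RInt_correct (V := R_CompleteNormedModule)), ex_RInt_ex_derive; [lra|].
  intros u Hu; now apply ex_derive_neumann_kernel. }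
apply (is_RInt_sum_f_R0 _ _ _ _ N) in Y; apply (is_RInt_sum_f_R0 _ _ _ _ N) in Z.
apply (is_RInt_unique (V := R_CompleteNormedModule)) in Y.
rewrite (RInt_ext _ (fun u => sum_f_R0 (fun n => c n * (legendre (2 * n) u / (1 - k * u))) N)).
2:{ intros u _; unfold Rdiv; rewrite Rmult_comm, scal_sum; apply sum_eq; intros n _; ring. }
rewrite Y.
rewrite <- (is_RInt_unique (V := R_CompleteNormedModule) _ _ _ _ Z).
apply RInt_ge_0; [lra | eexists; exact Z |].
intros u Hu; assert (P := one_minus_mult_pos k u Hk ltac:(lra)).
replace (sum_f_R0 (fun n => c n * (neumann_node k u ^ (2 * n) / (1 - k * u))) N)
  with (/ (1 - k * u) * sum_f_R0 (fun n => c n * neumann_node k u ^ (2 * n)) N)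
  by (rewrite scal_sum; apply sum_eq; intros n _; unfold Rdiv; ring).
apply Rmult_le_pos; [now apply Rlt_le, Rinv_0_lt_compat|].
apply Hc, neumann_node_bound; [exact Hk | lra].
Qed.

(** * Positivity on spherical caps *)

(* [2 atan (q sin b / (1 - q cos b))] is the smooth form of the conjugate Poisson series [2 sum q^n sin (n b) / n]. *)
Definition poisson_primitive (k b : R) : R :=
  let q := k / (1 + sqrt (1 - k ^ 2)) in
  (b + 2 * atan (q * sin b / (1 - q * cos b))) / sqrt (1 - k ^ 2).

(** The parameter [q] rationalises [sqrt (1 - k ^ 2)] and turns [1 / (1 - k cos b)] into
    [(1 + q ^ 2) / (1 - 2 q cos b + q ^ 2)], a multiple of the Poisson kernel. *)
Lemma poisson_ratio (k : R) : Rabs k < 1 ->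
  let S := sqrt (1 - k ^ 2) in let q := k / (1 + S) in
  0 < S /\ -1 < q < 1 /\ S = (1 - q ^ 2) / (1 + q ^ 2) /\ k = 2 * q / (1 + q ^ 2).
Proof.
intros Hk S q; apply Rabs_def2 in Hk.
assert (P : 0 < 1 - k ^ 2) by nra.
assert (HS : 0 < S) by now apply sqrt_lt_R0.
assert (E : S * S = 1 - k ^ 2) by (apply sqrt_sqrt; lra).
assert (Eq : q * (1 + S) = k) by (unfold q; field; lra).
assert (Q2 : q ^ 2 * (1 + S) = 1 - S).
{ apply Rmult_eq_reg_r with (1 + S); [|lra].
  transitivity ((q * (1 + S)) ^ 2); [ring | rewrite Eq; lra]. }
assert (0 < 1 + q ^ 2) by nra.
split; [exact HS|]; split; [|split].
- split; nra.
- apply Rmult_eq_reg_r with (1 + q ^ 2); [field_simplify; lra | lra].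
- apply Rmult_eq_reg_r with (1 + q ^ 2); [|lra].
  transitivity (2 * q); [|field; lra].
  rewrite <- Eq; transitivity (q * ((1 + S) + q ^ 2 * (1 + S))); [ring|].
  rewrite Q2; ring.
Qed.

Lemma one_minus_mult_cos_pos (q b : R) : -1 < q < 1 -> 0 < 1 - q * cos b.
Proof. intros Hq; assert (H := COS_bound b); destruct (Rle_dec 0 q); nra. Qed.

Lemma is_derive_poisson_primitive (k b : R) : Rabs k < 1 ->
  is_derive (poisson_primitive k) b (/ (1 - k * cos b)).
Proof.
intros Hk; destruct (poisson_ratio k Hk) as [HS [Hq [ES Ek]]].
assert (Pk : 0 < 1 - k * cos b)
  by (apply one_minus_mult_cos_pos; apply Rabs_def2 in Hk; lra).
unfold poisson_primitive.
set (S := sqrt (1 - k ^ 2)) in *; set (q := k / (1 + S)) in *; cbv zeta.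
assert (Pq := one_minus_mult_cos_pos q b Hq).
auto_derive; [repeat split; lra|].
assert (T := sin2_cos2 b); unfold Rsqr in T.
assert (N : 0 < 1 + q ^ 2) by nra.
assert (M : 0 < 1 - q ^ 2) by nra.
(* Once [q] is opaque, [k] and [S] are rational in it, and what remains is an identity in [q], [s],
   [c] modulo [s * s + c * c = 1]. *)
clearbody q; rewrite Ek in Pk; rewrite ES, Ek.
set (s := sin b) in *; set (c := cos b) in *.
assert (W : 0 < 1 + q ^ 2 - 2 * q * c).
{ replace (1 + q ^ 2 - 2 * q * c) with ((1 + q ^ 2) * (1 - 2 * q / (1 + q ^ 2) * c))
    by (field; lra).
  now apply Rmult_lt_0_compat. }
assert (D : 1 + (q * s / (1 + - (q * c))) ^ 2 = (1 + q ^ 2 - 2 * q * c) / (1 - q * c) ^ 2).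
{ apply Rmult_eq_reg_r with ((1 - q * c) ^ 2); [|nra].
  transitivity ((1 - q * c) ^ 2 + q ^ 2 * (s * s)); [field; lra|].
  replace (s * s) with (1 - c * c) by lra; field; lra. }
replace (1 + q * s * / (1 + - (q * c)) * (q * s * / (1 + - (q * c)) * 1))
  with (1 + (q * s / (1 + - (q * c))) ^ 2) by (unfold Rdiv; ring).
rewrite D.
replace (q * (1 * c) * / (1 + - (q * c)) +
    q * s * (- - (q * (1 * - s)) * / ((1 + - (q * c)) * (1 + - (q * c)))))
  with ((q * c * (1 - q * c) - q ^ 2 * (s * s)) / (1 - q * c) ^ 2) by (field; lra).
replace (s * s) with (1 - c * c) by lra.
eqR; field; repeat split; try lra; nra.
Qed.

(** [1 / sqrt (1 - (a u) ^ 2)] is the mean over [b] in [[0, PI]] of [1 / (1 - a u cos b)]. Instead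
    of exchanging two integrals, [Psi] integrates the primitive in [b]: [Psi 0 = 0], [Psi PI] is
    [PI] times the wanted integral, and the derivative of [Psi] is nonnegative by hypothesis, so the
    mean value theorem concludes. *)
Lemma legendre_weight_nonneg (H : R -> R) (a : R) : 0 < a < 1 ->
  (forall u, ex_derive H u) ->
  (forall k, Rabs k < 1 -> 0 <= RInt (fun u => H u / (1 - k * u)) (-1) 1) ->
  0 <= RInt (fun u => H u / sqrt (1 - (a * u) ^ 2)) (-1) 1.
Proof.
intros Ha HH Hpos; assert (Hpi := PI_RGT_0).
assert (K : forall u, -1 <= u <= 1 -> Rabs (a * u) < 1) by (intros u Hu; apply Rabs_def1; nra).
set (Psi := fun b => RInt (fun u => H u * poisson_primitive (a * u) b) (-1) 1).
assert (Ex : forall b u, -1 <= u <= 1 -> ex_derive (fun u => H u * poisson_primitive (a * u) b) u).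
{ intros b u Hu; destruct (poisson_ratio (a * u) (K u Hu)) as [HS [Hq _]].
  assert (Pq := one_minus_mult_cos_pos _ b Hq).
  assert (0 < 1 - (a * u) ^ 2) by (assert (B := K u Hu); apply Rabs_def2 in B; nra).
  unfold poisson_primitive; cbv zeta; auto_derive.
  replace (1 + - (a * u * (a * u * 1))) with (1 - (a * u) ^ 2) by ring.
  unfold Rdiv in Pq; repeat split; try apply HH; lra. }
assert (D : forall b, is_derive Psi b (RInt (fun u => H u / (1 - a * cos b * u)) (-1) 1)).
{ intros b.
  rewrite (RInt_ext _ (fun u => Derive (fun b => H u * poisson_primitive (a * u) b) b)).
  2:{ rewrite Rmin_left, Rmax_right by lra; intros u Hu; symmetry; apply is_derive_unique.
      assert (P := is_derive_poisson_primitive (a * u) b (K u ltac:(lra))).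
      replace (H u / (1 - a * cos b * u)) with (H u * / (1 - a * u * cos b))
        by (unfold Rdiv; do 2 f_equal; ring).
      apply is_derive_scal, P. }
  apply (is_derive_RInt_param (fun b u => H u * poisson_primitive (a * u) b));
    rewrite ?Rmin_left, ?Rmax_right by lra.
  - apply filter_forall; intros x t Ht.
    eexists; apply is_derive_scal, is_derive_poisson_primitive, K, Ht.
  - intros t Ht.
    apply continuity_2d_pt_ext_loc with (fun u v => H v * / (1 - a * v * cos u)).
    (* The radius [/ a - 1] is the room left around [[-1, 1]] before [a * v] leaves the open
       interval [(-1, 1)]. *)
    + assert (Hd : 0 < / a - 1) by (apply Rlt_0_minus; rewrite <- Rinv_1; apply Rinv_lt_contravar; lra).
      exists (mkposreal _ Hd); simpl; intros u v _ Hv; symmetry; apply is_derive_unique.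
      apply is_derive_scal, is_derive_poisson_primitive.
      apply Rabs_def2 in Hv; assert (a * / a = 1) by (apply Rinv_r; lra).
      apply Rabs_def1; nra.
    + apply continuity_2d_pt_mult.
      * apply continuity_1d_2d_pt_comp with (f := H) (g := fun _ v => v); [|apply continuity_2d_pt_id2].
        apply continuity_pt_filterlim, (ex_derive_continuous (V := R_NormedModule)), HH.
      * apply continuity_2d_pt_inv.
        -- apply continuity_2d_pt_minus; [apply continuity_2d_pt_const|].
           apply continuity_2d_pt_mult.
           ++ apply continuity_2d_pt_mult; [apply continuity_2d_pt_const | apply continuity_2d_pt_id2].
           ++ apply continuity_1d_2d_pt_comp with (f := cos) (g := fun u _ => u);
                [apply continuity_cos | apply continuity_2d_pt_id1].
        -- assert (B := K t Ht); apply Rabs_def2 in B.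
           assert (0 < 1 - a * t * cos b) by (apply one_minus_mult_cos_pos; lra); lra.
  - apply filter_forall; intros y; apply ex_RInt_ex_derive; [lra|]; apply Ex. }
destruct (MVT_gen Psi 0 PI (fun b => RInt (fun u => H u / (1 - a * cos b * u)) (-1) 1))
  as [c [_ E]].
- intros x _; apply D.
- intros x _; apply continuity_pt_filterlim, (ex_derive_continuous (V := R_NormedModule)).
  eexists; apply D.
- assert (E0 : Psi 0 = 0).
  { unfold Psi; rewrite (RInt_ext _ (fun _ => 0)).
    - rewrite RInt_const; apply Rmult_0_r.
    - intros u _; unfold poisson_primitive; rewrite sin_0, Rmult_0_r; unfold Rdiv.
      rewrite Rmult_0_l, atan_0; eqR; ring. }
  assert (E1 : Psi PI = PI * RInt (fun u => H u / sqrt (1 - (a * u) ^ 2)) (-1) 1).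
  { unfold Psi; rewrite (RInt_ext _ (fun u => PI * (H u / sqrt (1 - (a * u) ^ 2)))).
    - apply (is_RInt_unique (V := R_CompleteNormedModule)), is_RInt_Rmult.
      apply (RInt_correct (V := R_CompleteNormedModule)), ex_RInt_ex_derive; [lra|].
      intros u Hu; destruct (poisson_ratio (a * u) (K u Hu)) as [HS _].
      assert (0 < 1 - (a * u) ^ 2) by (assert (B := K u Hu); apply Rabs_def2 in B; nra).
      auto_derive.
      replace (1 + - (a * u * (a * u * 1))) with (1 - (a * u) ^ 2) by ring.
      repeat split; try apply HH; lra.
    - intros u _; unfold poisson_primitive; rewrite sin_PI, Rmult_0_r; unfold Rdiv.
      rewrite Rmult_0_l, atan_0; eqR; ring. }
  assert (0 <= RInt (fun u => H u / (1 - a * cos c * u)) (-1) 1).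
  { apply Hpos; assert (B := COS_bound c); apply Rabs_def1; nra. }
  rewrite E0, E1 in E.
  apply Rmult_le_reg_l with PI; [lra|]; nra.
Qed.

(** The substitution [u = sin x / sin p] turns [dx] into [sin p / sqrt (1 - (sin p * u) ^ 2) du];
    for [p < PI / 2] this weight is smooth up to the endpoints. *)
Lemma cap_integral_nonneg (H : R -> R) (p : R) : 0 < p < PI / 2 ->
  (forall u, ex_derive H u) ->
  (forall k, Rabs k < 1 -> 0 <= RInt (fun u => H u / (1 - k * u)) (-1) 1) ->
  0 <= RInt (fun x => H (sin x / sin p)) (- p) p.
Proof.
intros Hp HH Hpos; assert (Hpi := PI_RGT_0).
assert (S0 : 0 < sin p) by (apply sin_gt_0; lra).
assert (S1 : sin p < 1).
{ rewrite <- sin_PI2; apply sin_increasing_1; lra. }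
assert (W := legendre_weight_nonneg H (sin p) (conj S0 S1) HH Hpos).
assert (E : RInt (fun x => cos x / sin p *
     (sin p * (H (sin x / sin p) / sqrt (1 - (sin p * (sin x / sin p)) ^ 2)))) (- p) p
  = RInt (fun u => sin p * (H u / sqrt (1 - (sin p * u) ^ 2))) (-1) 1).
{ replace (RInt _ (-1) 1) with (RInt (fun u => sin p * (H u / sqrt (1 - (sin p * u) ^ 2)))
     (sin (- p) / sin p) (sin p / sin p)).
  2:{ f_equal; [rewrite sin_neg|]; field; lra. }
  apply (RInt_comp (V := R_CompleteNormedModule)
     (fun u => sin p * (H u / sqrt (1 - (sin p * u) ^ 2))) (fun x => sin x / sin p)
     (fun x => cos x / sin p)); rewrite Rmin_left, Rmax_right by lra; intros x Hx.
  - assert (0 < 1 - (sin p * (sin x / sin p)) ^ 2).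
    { replace (sin p * (sin x / sin p)) with (sin x) by (field; lra).
      assert (T := sin2_cos2 x); unfold Rsqr in T.
      assert (0 < cos x) by (apply cos_gt_0; lra); nra. }
    apply (ex_derive_continuous (V := R_NormedModule)).
    auto_derive.
    match goal with |- context [sqrt ?e] =>
      replace e with (1 - (sin p * (sin x / sin p)) ^ 2) by ring end.
    repeat split; try apply HH; [lra|].
    now apply Rgt_not_eq, sqrt_lt_R0.
  - split; [auto_derive; [lra | eqR; field; lra]|].
    apply (ex_derive_continuous (V := R_NormedModule)); auto_derive; easy. }
rewrite (RInt_ext _ (fun x => cos x / sin p *
     (sin p * (H (sin x / sin p) / sqrt (1 - (sin p * (sin x / sin p)) ^ 2))))).
- rewrite E.
  rewrite (is_RInt_unique (V := R_CompleteNormedModule) _ _ _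
    (sin p * RInt (fun u => H u / sqrt (1 - (sin p * u) ^ 2)) (-1) 1)).
  + apply Rmult_le_pos; lra.
  + apply is_RInt_Rmult, (RInt_correct (V := R_CompleteNormedModule)), ex_RInt_ex_derive; [lra|].
    intros u Hu; assert (-1 < sin p * u < 1) by nra; assert (0 < 1 - (sin p * u) ^ 2) by nra.
    auto_derive.
    replace (1 + - (sin p * u * (sin p * u * 1))) with (1 - (sin p * u) ^ 2) by ring.
    repeat split; try apply HH; [lra|].
    now apply Rgt_not_eq, sqrt_lt_R0.
- rewrite Rmin_left, Rmax_right by lra; intros x Hx.
  replace (sin p * (sin x / sin p)) with (sin x) by (field; lra).
  assert (0 < cos x) by (apply cos_gt_0; lra).
  assert (T := sin2_cos2 x); unfold Rsqr in T.
  replace (1 - sin x ^ 2) with (cos x ^ 2) by lra.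
  rewrite sqrt_pow2 by lra; eqR; field; lra.
Qed.

(** * The limiting cap [p = PI / 2] *)

Lemma ex_derive_scaled_legendre_sin (m j : nat) (c x : R) :
  ex_derive (fun y => sin y ^ j * legendre m (sin y * c)) x.
Proof. auto_derive; repeat split; apply ex_derive_legendre. Qed.

(** The variable [x] occurs both in the limits and in the integrand. The exponent [j] makes the
    induction close: in Bonnet's recurrence the factor [sin y / sin x] raises [j] by one and leaves
    [/ sin x] outside the integral, until only moments of [sin y] remain, which depend on [x]
    through the limits alone. *)
Lemma cap_moment_continuous (m j : nat) :
  continuous (fun x => RInt (fun y => sin y ^ j * legendre m (sin y / sin x)) (- x) x) (PI / 2).
Proof.
assert (Ex : forall m j x, ex_RInt (fun y => sin y ^ j * legendre m (sin y / sin x)) (- x) x).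
{ intros n i x; apply (ex_RInt_continuous (V := R_CompleteNormedModule)).
  intros z _; apply (ex_derive_continuous (V := R_NormedModule)), ex_derive_scaled_legendre_sin. }
set (J := fun m j x => (RInt (fun y => sin y ^ j * legendre m (sin y / sin x)) (- x) x : R)).
assert (Y : forall m j x,
  is_RInt (fun y => sin y ^ j * legendre m (sin y / sin x)) (- x) x (J m j x)).
{ intros n i x; apply (RInt_correct (V := R_CompleteNormedModule)), Ex. }
change (continuous (J m j : R_UniformSpace -> R_UniformSpace) (PI / 2)).
assert (Sc : continuous (fun x => / sin x) (PI / 2)).
{ apply (ex_derive_continuous (V := R_NormedModule)); auto_derive; rewrite sin_PI2; lra. }
assert (IH0 : forall j, continuous (J O j : R_UniformSpace -> R_UniformSpace) (PI / 2)).
{ clear m j; intros j.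
  set (F := fun x : R => (RInt (fun y => sin y ^ j) 0 x : R)).
  assert (D : forall x, is_derive F x (sin x ^ j)).
  { intros x; apply (is_derive_RInt (V := R_NormedModule) (fun y => sin y ^ j) F 0).
    - apply filter_forall; intros y; apply (RInt_correct (V := R_CompleteNormedModule)).
      apply (ex_RInt_continuous (V := R_CompleteNormedModule)).
      intros z _; apply (ex_derive_continuous (V := R_NormedModule)); auto_derive; easy.
    - apply (ex_derive_continuous (V := R_NormedModule)); auto_derive; easy. }
  refine (continuous_ext (T := R_UniformSpace) (U := R_UniformSpace) (fun x => F x - F (- x)) _ _ _ _).
  + intros x; symmetry; apply (is_RInt_unique (V := R_CompleteNormedModule)).
    apply (is_RInt_derive (V := R_CompleteNormedModule)).
    * intros y _; simpl; rewrite Rmult_1_r; apply D.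
    * intros y _; apply (ex_derive_continuous (V := R_NormedModule)); simpl; auto_derive; easy.
  + apply (ex_derive_continuous (V := R_NormedModule)).
    auto_derive; repeat split; eexists; apply D. }
revert j; pattern m; apply nat_pair_ind; clear m; [exact IH0 | |].
- intros j.
  refine (continuous_ext (T := R_UniformSpace) (U := R_UniformSpace) (fun x => / sin x * J O (S j) x) _ _ _ _).
  + intros x; symmetry; apply (is_RInt_unique (V := R_CompleteNormedModule)).
    apply (is_RInt_ext (fun y => / sin x * (sin y ^ S j * legendre 0 (sin y / sin x)))).
    * intros y _; rewrite <- tech_pow_Rmult; simpl legendre; unfold Rdiv; eqR; ring.
    * exact (is_RInt_Rmult _ _ _ _ _ (Y O (S j) x)).
  + apply (continuous_mult (K := R_AbsRing)); [exact Sc | apply IH0].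
- intros n IH1 IH2 j.
  assert (0 <= INR n) by apply pos_INR.
  refine (continuous_ext (T := R_UniformSpace) (U := R_UniformSpace) (fun x => / (INR n + 2) *
     ((2 * INR n + 3) * (/ sin x * J (S n) (S j) x) + (- (INR n + 1)) * J n j x)) _ _ _ _).
  + intros x; symmetry; apply (is_RInt_unique (V := R_CompleteNormedModule)).
    apply (is_RInt_ext (fun y => / (INR n + 2) *
       ((2 * INR n + 3) * (/ sin x * (sin y ^ S j * legendre (S n) (sin y / sin x)))
        + (- (INR n + 1)) * (sin y ^ j * legendre n (sin y / sin x))))).
    * intros y _; eqR; apply Rmult_eq_reg_l with (INR n + 2); [|lra].
      rewrite <- Rmult_assoc, Rinv_r, Rmult_1_l by lra.
      transitivity (sin y ^ j * ((INR n + 2) * legendre (S (S n)) (sin y / sin x)));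
        [|ring].
      rewrite legendre_bonnet, <- tech_pow_Rmult; unfold Rdiv; ring.
    * exact (is_RInt_Rmult _ _ _ _ _ (is_RInt_Rplus _ _ _ _ _ _
        (is_RInt_Rmult _ _ _ _ _ (is_RInt_Rmult _ _ _ _ _ (Y (S n) (S j) x)))
        (is_RInt_Rmult _ _ _ _ _ (Y n j x)))).
  + apply (continuous_scal_r (K := R_AbsRing) (V := R_NormedModule)).
    apply (continuous_plus (K := R_AbsRing) (V := R_NormedModule));
      apply (continuous_scal_r (K := R_AbsRing) (V := R_NormedModule)); [|apply IH1].
    apply (continuous_mult (K := R_AbsRing)); [exact Sc | apply IH2].
Qed.

Lemma cap_legendre_continuous (c : nat -> R) (N : nat) :
  continuous (fun x => RInt (fun y => sum_f_R0 (fun n => c n * legendre (2 * n) (sin y / sin x)) N)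
    (- x) x) (PI / 2).
Proof.
assert (Ex : forall m x, ex_RInt (fun y => legendre m (sin y / sin x)) (- x) x).
{ intros n x; apply (ex_RInt_continuous (V := R_CompleteNormedModule)).
  intros z _; apply (ex_derive_continuous (V := R_NormedModule)).
  apply ex_derive_ext with (2 := ex_derive_scaled_legendre_sin n 0 (/ sin x) z).
  intros y; simpl; apply Rmult_1_l. }
refine (continuous_ext (T := R_UniformSpace) (U := R_UniformSpace) (fun x => sum_f_R0 (fun n => c n *
   RInt (fun y => legendre (2 * n) (sin y / sin x)) (- x) x) N) _ _ _ _).
{ intros x; symmetry; apply (is_RInt_unique (V := R_CompleteNormedModule)).
  apply is_RInt_sum_f_R0; intros n; apply is_RInt_Rmult.
  apply (RInt_correct (V := R_CompleteNormedModule)), Ex. }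
assert (C : forall n, continuous (fun x => c n *
   RInt (fun y => legendre (2 * n) (sin y / sin x)) (- x) x) (PI / 2)).
{ intros n; apply (continuous_scal_r (K := R_AbsRing) (V := R_NormedModule)).
  refine (continuous_ext (T := R_UniformSpace) (U := R_UniformSpace) (fun x =>
    RInt (fun y => sin y ^ 0 * legendre (2 * n) (sin y / sin x)) (- x) x) _ _ _ _); [|apply cap_moment_continuous].
  intros x; apply RInt_ext; intros y _; simpl; apply Rmult_1_l. }
induction N as [|N IH]; [apply C|].
apply (continuous_plus (K := R_AbsRing) (V := R_NormedModule)); [exact IH | apply C].
Qed.

Lemma ex_derive_legendre_sum (c : nat -> R) (N : nat) (u : R) :
  ex_derive (fun u => sum_f_R0 (fun n => c n * legendre (2 * n) u) N) u.
Proof.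
assert (T : forall n, ex_derive (fun u => c n * legendre (2 * n) u) u)
  by (intros n; exact (ex_derive_scal _ (c n) u (ex_derive_legendre (2 * n) u))).
induction N as [|N IH]; [exact (T O)|].
exact (ex_derive_plus (K := R_AbsRing) (V := R_NormedModule) _ _ u IH (T (S N))).
Qed.

Lemma cap_legendre_sum_nonneg (c : nat -> R) (N : nat) (p : R) : 0 < p <= PI / 2 ->
  (forall x, -1 <= x <= 1 -> 0 <= sum_f_R0 (fun n => c n * x ^ (2 * n)) N) ->
  0 <= RInt (fun y => sum_f_R0 (fun n => c n * legendre (2 * n) (sin y / sin p)) N) (- p) p.
Proof.
intros [Hp Hp2] Hc; assert (Hpi := PI_RGT_0).
assert (Main : forall x, 0 < x < PI / 2 ->
  0 <= RInt (fun y => sum_f_R0 (fun n => c n * legendre (2 * n) (sin y / sin x)) N) (- x) x).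
{ intros x Hx; apply (cap_integral_nonneg (fun u => sum_f_R0 (fun n => c n * legendre (2 * n) u) N));
    [exact Hx | |].
  - apply ex_derive_legendre_sum.
  - intros k Hk; now apply legendre_kernel_sum_nonneg. }
destruct Hp2 as [Hp2 | ->]; [now apply Main|].
set (J := fun x => RInt (fun y => sum_f_R0 (fun n => c n * legendre (2 * n) (sin y / sin x)) N) (- x) x) in *.
change (0 <= J (PI / 2)).
apply Rnot_lt_le; intros Neg.
assert (C := cap_legendre_continuous c N); fold J in C.
apply continuity_pt_filterlim in C.
destruct (C (- J (PI / 2))) as [d [Hd HC]]; [lra|].
(* If the value at [PI / 2] were negative, so would be the value at some smaller angle; [d / 2]
   keeps [x] within the modulus of continuity and [PI / 4] keeps it positive. *)
set (x := Rmax (PI / 4) (PI / 2 - d / 2)).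
assert (Bx : PI / 4 <= x < PI / 2 /\ PI / 2 - d / 2 <= x)
  by (unfold x, Rmax; destruct (Rle_dec _ _); lra).
assert (M := Main x ltac:(lra)); fold (J x) in M.
specialize (HC x); simpl in HC; unfold R_dist, D_x, no_cond in HC.
assert (X : Rabs (J x - J (PI / 2)) < - J (PI / 2)).
{ apply HC; split; [split; [exact I | lra]|].
  apply Rabs_def1; lra. }
apply Rabs_def2 in X; lra.
Qed.

(** * From positivity to bounds *)

Lemma sum_add_constant_term (A e : R) (c g : nat -> R) (N : nat) :
  sum_f_R0 (fun n => (match n with O => A | _ => 0 end + e * c n) * g n) N
  = A * g O + e * sum_f_R0 (fun n => c n * g n) N.
Proof.
induction N as [|N IH]; simpl; [ring|].
simpl in IH; rewrite IH; ring.
Qed.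

(** Positivity is applied to [A + f] and [A - f]. The constant [A] is absorbed into the coefficient
    of index zero, where both [x ^ 0] and [P_0] equal [1], and contributes [A] times the length
    [2 * p]. *)
Lemma cap_legendre_sum_bound (c : nat -> R) (N : nat) (p A : R) : 0 < p <= PI / 2 ->
  (forall x, -1 <= x <= 1 -> Rabs (sum_f_R0 (fun n => c n * x ^ (2 * n)) N) <= A) ->
  Rabs (RInt (fun y => sum_f_R0 (fun n => c n * legendre (2 * n) (sin y / sin p)) N) (- p) p)
  <= 2 * p * A.
Proof.
intros Hp Hc.
assert (Y : ex_RInt (fun y => sum_f_R0 (fun n => c n * legendre (2 * n) (sin y / sin p)) N) (- p) p).
{ eexists; apply is_RInt_sum_f_R0; intros n; apply is_RInt_Rmult.
  apply (RInt_correct (V := R_CompleteNormedModule)), ex_RInt_ex_derive; [lra|].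
  intros z _; apply ex_derive_ext with (2 := ex_derive_scaled_legendre_sin (2 * n) 0 (/ sin p) z).
  intros y; simpl pow; apply Rmult_1_l. }
apply (RInt_correct (V := R_CompleteNormedModule)) in Y.
set (l := RInt _ (- p) p) in *.
assert (P : forall e, e = 1 \/ e = -1 -> 0 <= (p - - p) * A + e * l).
{ intros e He.
  rewrite <- (is_RInt_unique (V := R_CompleteNormedModule) _ _ _ _
     (is_RInt_Rplus _ _ _ _ _ _ (is_RInt_Rconst A (- p) p) (is_RInt_Rmult _ e _ _ _ Y))).
  rewrite (RInt_ext _ (fun y => sum_f_R0 (fun n => (match n with O => A | _ => 0 end + e * c n)
      * legendre (2 * n) (sin y / sin p)) N)).
  2:{ intros y _; rewrite sum_add_constant_term; simpl legendre; eqR; ring. }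
  apply cap_legendre_sum_nonneg; [exact Hp|].
  intros x Hx; rewrite sum_add_constant_term, Rmult_1_r.
  assert (B := Hc x Hx); apply Rabs_le_between in B; destruct He; subst e; lra. }
assert (P1 := P 1 ltac:(lra)); assert (P2 := P (-1) ltac:(lra)).
apply Rabs_le; lra.
Qed.

(** * Gaussian averages *)

Definition laplace_average (a u : R) : R :=
  RInt (fun s => Re (Cexp (- (RtoC a * laplace_point u (sqrt (1 - u ^ 2)) s ^ 2))%C)) (- PI) PI.

Lemma laplace_integrand_eq (a u q s : R) :
  Re (Cexp (- (RtoC a * laplace_point u q s ^ 2))%C)
  = exp (- (a * (u ^ 2 - q ^ 2 * sin s ^ 2))) * cos (2 * a * u * q * sin s).
Proof.
unfold Cexp, laplace_point, RtoC; simpl; unfold Cmult, Copp; simpl; f_equal; f_equal; ring.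
Qed.

Lemma is_RInt_laplace_average (a u : R) :
  is_RInt (fun s => Re (Cexp (- (RtoC a * laplace_point u (sqrt (1 - u ^ 2)) s ^ 2))%C))
    (- PI) PI (laplace_average a u).
Proof.
apply (RInt_correct (V := R_CompleteNormedModule)), ex_RInt_ex_derive.
{ assert (H := PI_RGT_0); lra. }
intros s _; eapply ex_derive_ext; [intros t; symmetry; apply laplace_integrand_eq|].
auto_derive; easy.
Qed.

(** The squared modulus [u ^ 2 + (1 - u ^ 2) * sin s ^ 2] is a convex combination of [1] and
    [sin s ^ 2]. This keeps the exponent of the Gaussian in a fixed disc, so that its Taylor sums
    converge uniformly in [u] and [s]. *)
Lemma Cmod_laplace_point (u s : R) : -1 <= u <= 1 ->
  Cmod (laplace_point u (sqrt (1 - u ^ 2)) s) <= 1.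
Proof.
intros Hu; change (sqrt (u ^ 2 + (- (sqrt (1 - u ^ 2) * sin s)) ^ 2) <= 1).
apply Rle_trans with (sqrt 1); [|rewrite sqrt_1; lra]; apply sqrt_le_1_alt.
replace ((- (sqrt (1 - u ^ 2) * sin s)) ^ 2) with ((sqrt (1 - u ^ 2)) ^ 2 * sin s ^ 2) by ring.
rewrite pow2_sqrt by nra.
assert (T := sin2_cos2 s); unfold Rsqr in T.
assert (0 <= (1 - u ^ 2) * (cos s * cos s)) by (apply Rmult_le_pos; nra).
nra.
Qed.

Definition gauss_coeff (a : R) (k : nat) : R := / INR (fact k) * (- a) ^ k.

Lemma Re_pow_gauss (a : R) (z : C) (k : nat) :
  / INR (fact k) * Re ((- (RtoC a * z ^ 2)) ^ k)%C = gauss_coeff a k * Re (z ^ (2 * k))%C.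
Proof.
replace (- (RtoC a * z ^ 2))%C with (RtoC (- a) * z ^ 2)%C by (rewrite RtoC_opp; ring).
rewrite Cpow_mult_l, <- RtoC_pow, Cpow_mult_r.
unfold gauss_coeff; rewrite Rmult_assoc; f_equal.
unfold Re, Cmult, RtoC; simpl; ring.
Qed.

Lemma Cmod_gauss_argument (a : R) (z : C) : 0 <= a -> Cmod z <= 1 ->
  Cmod (- (RtoC a * z ^ 2))%C <= a.
Proof.
intros Ha Hz; rewrite Cmod_opp, Cmod_mult, Cmod_R, Cmod_pow, (Rabs_pos_eq a Ha).
assert (0 <= Cmod z) by apply Cmod_ge_0.
assert (Cmod z ^ 2 <= 1) by nra; nra.
Qed.

(** On the real segment the series sums to [exp (- (a * x ^ 2))], at most [1] for every [a]; only
    the rank [N] depends on [a]. Here the exponential growth in [1 / h] disappears. *)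
Lemma gauss_sum_bound (a eps : R) : 0 <= a -> 0 < eps ->
  exists N, forall n x, (N <= n)%nat -> -1 <= x <= 1 ->
    Rabs (sum_f_R0 (fun k => gauss_coeff a k * x ^ (2 * k)) n) <= 1 + eps.
Proof.
intros Ha He; destruct (Re_Cexp_taylor_uniform a eps Ha He) as [N HN].
exists N; intros n x Hn Hx.
specialize (HN n (- (RtoC a * RtoC x ^ 2))%C Hn).
assert (Hm : Cmod (RtoC x) <= 1) by (rewrite Cmod_R; apply Rabs_le; lra).
specialize (HN (Cmod_gauss_argument a _ Ha Hm)).
rewrite (sum_eq _ (fun k => gauss_coeff a k * x ^ (2 * k))) in HN.
2:{ intros k _; rewrite Re_pow_gauss, <- RtoC_pow; reflexivity. }
assert (E : 0 < Re (Cexp (- (RtoC a * RtoC x ^ 2))%C) <= 1).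
{ replace (Re (Cexp (- (RtoC a * RtoC x ^ 2))%C)) with (exp (- (a * x ^ 2))).
  - split; [apply exp_pos|].
    rewrite <- exp_0; destruct (Req_dec (a * x ^ 2) 0) as [-> | Z]; [rewrite Ropp_0; lra|].
    apply Rlt_le, exp_increasing; nra.
  - unfold Cexp, RtoC; simpl; unfold Cmult, Copp; simpl.
    match goal with |- _ = ?b * cos ?e =>
      replace e with 0 by ring; rewrite cos_0; transitivity b; [f_equal; ring | ring] end. }
apply Rabs_def2 in HN; apply Rabs_le; lra.
Qed.

Lemma laplace_average_taylor (a eps : R) : 0 <= a -> 0 < eps ->
  exists N, forall n u, (N <= n)%nat -> -1 <= u <= 1 ->
    Rabs (laplace_average a u
          - 2 * PI * sum_f_R0 (fun k => gauss_coeff a k * legendre (2 * k) u) n) <= 2 * PI * eps.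
Proof.
intros Ha He; destruct (Re_Cexp_taylor_uniform a eps Ha He) as [N HN].
assert (Hpi := PI_RGT_0).
exists N; intros n u Hn Hu.
set (Z := laplace_point u (sqrt (1 - u ^ 2))).
assert (Q : u ^ 2 + sqrt (1 - u ^ 2) ^ 2 = 1) by (rewrite pow2_sqrt by nra; ring).
assert (S : is_RInt (fun s => sum_f_R0 (fun k => gauss_coeff a k * Re (Z s ^ (2 * k))%C) n) (- PI) PI
   (sum_f_R0 (fun k => gauss_coeff a k * (2 * PI * legendre (2 * k) u)) n)).
{ apply is_RInt_sum_f_R0; intros k; apply is_RInt_Rmult, legendre_laplace, Q. }
assert (L : is_RInt (fun s => Re (Cexp (- (RtoC a * Z s ^ 2))%C)) (- PI) PI (laplace_average a u))
  by exact (is_RInt_laplace_average a u).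
assert (D := is_RInt_Rplus _ _ _ _ _ _ L (is_RInt_Rmult _ (-1) _ _ _ S)).
assert (B := is_RInt_abs_bound _ (- PI) PI _ eps ltac:(lra) D); cbv beta in B.
replace (2 * PI * sum_f_R0 (fun k => gauss_coeff a k * legendre (2 * k) u) n)
  with (sum_f_R0 (fun k => gauss_coeff a k * (2 * PI * legendre (2 * k) u)) n)
  by (rewrite scal_sum; apply sum_eq; intros k _; ring).
match type of B with _ -> Rabs ?x <= _ => match goal with |- Rabs ?y <= _ =>
  replace y with x by ring end end.
replace (2 * PI * eps) with ((PI - - PI) * eps) by ring; apply B.
intros s _.
assert (T := HN n (- (RtoC a * Z s ^ 2))%C Hn
   (Cmod_gauss_argument a _ Ha (Cmod_laplace_point u s Hu))).
rewrite (sum_eq _ (fun k => gauss_coeff a k * Re (Z s ^ (2 * k))%C)) in T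
  by (intros k _; apply Re_pow_gauss).
apply Rlt_le; match type of T with Rabs ?x < _ => match goal with |- Rabs ?y < _ =>
  replace y with x by ring end end; exact T.
Qed.

Lemma cap_ratio_bound (p x : R) : 0 < p <= PI / 2 -> - p <= x <= p -> -1 <= sin x / sin p <= 1.
Proof.
intros Hp Hx; assert (Hpi := PI_RGT_0).
assert (0 < sin p) by (apply sin_gt_0; lra).
assert (sin x <= sin p) by (apply sin_incr_1; lra).
assert (L : sin (- p) <= sin x) by (apply sin_incr_1; lra).
rewrite sin_neg in L; split; [apply Rle_div_r | apply Rle_div_l]; lra.
Qed.

Lemma cap_laplace_average (a p : R) : 0 <= a -> 0 < p <= PI / 2 ->
  exists l, is_RInt (fun x => laplace_average a (sin x / sin p)) (- p) p l /\
    Rabs l <= 4 * PI * p.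
Proof.
intros Ha Hp; assert (Hpi := PI_RGT_0).
set (S := fun n u => 2 * PI * sum_f_R0 (fun k => gauss_coeff a k * legendre (2 * k) u) n).
(* The passage to the limit under the integral asks for uniform convergence on the whole line, while
   the Taylor estimate holds only for [|sin x / sin p| <= 1]; hence the cut-off. It also yields
   integrability of the limit. *)
set (f := fun n x => if Rle_dec (Rabs x) p then S n (sin x / sin p) else 0).
set (g := fun x => if Rle_dec (Rabs x) p then laplace_average a (sin x / sin p) else 0).
set (I := fun n => (RInt (fun y => sum_f_R0
   (fun k => gauss_coeff a k * legendre (2 * k) (sin y / sin p)) n) (- p) p : R)).
assert (In : forall n, is_RInt (f n) (- p) p (2 * PI * I n)).
{ intros n; apply (is_RInt_ext (fun x => S n (sin x / sin p))).
  - rewrite Rmin_left, Rmax_right by lra; intros x Hx; unfold f.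
    destruct (Rle_dec (Rabs x) p) as [_|F]; [reflexivity|].
    destruct F; apply Rabs_le; lra.
  - apply is_RInt_Rmult, (RInt_correct (V := R_CompleteNormedModule)).
    eexists; apply is_RInt_sum_f_R0; intros k; apply is_RInt_Rmult.
    apply (RInt_correct (V := R_CompleteNormedModule)), ex_RInt_ex_derive; [lra|].
    intros z _; apply ex_derive_ext with (2 := ex_derive_scaled_legendre_sin (2 * k) 0 (/ sin p) z).
    intros y; simpl pow; apply Rmult_1_l. }
destruct (filterlim_RInt (V := R_CompleteNormedModule) f (- p) p eventually _ g _ In)
  as [l [Hl Hg]].
{ apply filterlim_locally; intros eps.
  assert (He : 0 < eps / (4 * PI)) by (apply Rdiv_lt_0_compat; [apply cond_pos | lra]).
  destruct (laplace_average_taylor a _ Ha He) as [N HN].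
  exists N; intros n Hn x.
  change (Rabs (f n x - g x) < eps); unfold f, g.
  destruct (Rle_dec (Rabs x) p) as [Hx|_].
  - rewrite Rabs_minus_sym; eapply Rle_lt_trans; [apply HN; [exact Hn|]|].
    + apply cap_ratio_bound; [exact Hp|]; now apply Rabs_le_between.
    + assert (P := cond_pos eps).
      replace (2 * PI * (eps / (4 * PI))) with (eps / 2) by (field; lra); lra.
  - rewrite Rminus_0_r, Rabs_R0; apply cond_pos. }
exists l; split.
- apply is_RInt_ext with (2 := Hg).
  rewrite Rmin_left, Rmax_right by lra; intros x Hx; unfold g.
  destruct (Rle_dec (Rabs x) p) as [_|F]; [reflexivity|].
  destruct F; apply Rabs_le; lra.
- apply le_epsilon; intros eps He.
  (* The final error is [4 * PI * p * e] from the bound [1 + e] plus [e] from the limit; each is at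
     most [eps / 2]. *)
  set (e := Rmin (eps / 2) (eps / (8 * PI * p))).
  assert (H8 : 0 < 8 * PI * p) by (apply Rmult_lt_0_compat; lra).
  assert (He1 : 0 < e) by (apply Rmin_pos; [lra | apply Rdiv_lt_0_compat; assumption]).
  assert (e <= eps / 2) by apply Rmin_l.
  assert (e * (8 * PI * p) <= eps) by (apply Rle_div_r; [lra | apply Rmin_r]).
  destruct (gauss_sum_bound a e Ha He1) as [N1 HN1].
  destruct (proj1 (filterlim_locally _ _) Hl (mkposreal _ He1)) as [N2 HN2].
  set (n := max N1 N2).
  specialize (HN2 n ltac:(lia)).
  change (Rabs (2 * PI * I n - l) < e) in HN2.
  assert (B := cap_legendre_sum_bound (gauss_coeff a) n p (1 + e) Hp
     (fun x Hx => HN1 n x ltac:(lia) Hx)).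
  fold (I n) in B.
  assert (B' : Rabs (2 * PI * I n) <= 2 * PI * (2 * p * (1 + e))).
  { rewrite Rabs_mult, (Rabs_pos_eq (2 * PI)) by lra.
    apply Rmult_le_compat_l; [lra | exact B]. }
  replace (Rabs l) with (Rabs (2 * PI * I n - (2 * PI * I n - l))) by (f_equal; ring).
  eapply Rle_trans; [apply Rabs_triang|]; rewrite Rabs_Ropp.
  nra.
Qed.

(** * The rotated plane waves *)

(** With the angle measured from the second axis, [y >= |t|] reads [|x| <= p], and [y ^ 2 - t ^ 2]
    becomes [rho ^ 2 (sin p ^ 2 - sin x ^ 2) = (rho sin p) ^ 2 (1 - u ^ 2)]. The factor
    [rho * sin p] thus comes out of the whole argument of the Gaussian. *)
Lemma w_polar (h rho p x t : R) : 0 <= rho -> 0 < p <= PI / 2 -> - p <= x <= p ->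
  Rabs t = rho * cos p ->
  w h (rho * sin x) (rho * cos x) t
  = 1 / (4 * Rpower PI (3 / 2) * sqrt h)
    * laplace_average (1 / h * (rho * sin p) ^ 2) (sin x / sin p).
Proof.
intros Hr Hp Hx Ht; assert (Hpi := PI_RGT_0).
assert (Sp : 0 < sin p) by (apply sin_gt_0; lra).
assert (B := cap_ratio_bound p x Hp Hx).
set (u := sin x / sin p) in *.
assert (Eu : sin x = sin p * u) by (unfold u; field; lra).
assert (Er : sqrt ((rho * cos x) ^ 2 - t ^ 2) = rho * sin p * sqrt (1 - u ^ 2)).
{ rewrite <- (sqrt_pow2 (rho * sin p)) by (apply Rmult_le_pos; lra).
  rewrite <- sqrt_mult by nra; f_equal.
  rewrite <- (pow2_abs t), Ht.
  assert (T := sin2_cos2 x); assert (T2 := sin2_cos2 p); unfold Rsqr in T, T2.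
  transitivity (rho ^ 2 * (cos x * cos x - cos p * cos p)); [ring|].
  replace (cos x * cos x) with (1 - sin x * sin x) by lra.
  replace (cos p * cos p) with (1 - sin p * sin p) by lra.
  rewrite Eu; ring. }
unfold w; f_equal.
assert (W := w_integral_ex h (rho * sin x) (rho * cos x) t).
apply (RInt_correct (V := C_R_CompleteNormedModule)) in W.
apply (is_RInt_fct_extend_fst (U := R_NormedModule) (V := R_NormedModule)) in W.
rewrite <- (is_RInt_unique (V := R_CompleteNormedModule) _ _ _ _ W : RInt _ _ _ = Re _).
unfold laplace_average; apply RInt_ext; intros s _.
change (Re (w_integrand h (rho * sin x) (rho * cos x) t s)
  = Re (Cexp (- (RtoC (1 / h * (rho * sin p) ^ 2) * laplace_point u (sqrt (1 - u ^ 2)) s ^ 2))%C)).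
unfold w_integrand; rewrite Er, Eu; do 3 f_equal.
unfold laplace_point, Ci, RtoC; simpl; unfold Cminus, Cmult, Copp, Cplus; simpl.
apply injective_projections; simpl; ring.
Qed.

(** At the origin with [t = 0] the Heaviside argument is zero for every rotation angle, so this
    value, multiplied by [theta0], is the whole of [v] up to sign. *)
Lemma w_zero (h : R) : w h 0 0 0 = 1 / (4 * Rpower PI (3 / 2) * sqrt h) * (2 * PI).
Proof.
unfold w; f_equal.
rewrite (is_RInt_unique (V := C_R_CompleteNormedModule) _ _ _ (2 * PI, 0)); [reflexivity|].
apply (is_RInt_ext (V := C_R_NormedModule) (fun _ => (1, 0))).
- intros s _; rewrite w_integrand_eq.
  replace (0 ^ 2 - 0 ^ 2) with 0 by ring; rewrite sqrt_0.
  apply injective_projections; simpl.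
  + replace ((0 * (0 * 1) * (sin s * (sin s * 1)) - 0 * (0 * 1)) * / h) with 0 by ring.
    replace (2 * 0 * 0 * sin s * / h) with 0 by ring.
    rewrite exp_0, cos_0; ring.
  + replace (2 * 0 * 0 * sin s * / h) with 0 by ring.
    rewrite sin_0; ring.
- assert (H1 := is_RInt_Rconst 1 (- PI) PI); assert (H0 := is_RInt_Rconst 0 (- PI) PI).
  replace ((PI - - PI) * 1) with (2 * PI) in H1 by ring.
  rewrite Rmult_0_r in H0.
  exact (is_RInt_fct_extend_pair (U := R_NormedModule) (V := R_NormedModule)
         (fun _ => (1, 0)) (- PI) PI (2 * PI) 0 H1 H0).
Qed.

(** The range of [d] is the one that [is_RInt_shift_period] accepts. Since [acos] covers only
    [[0, PI]], negative [x] is handled by reflecting the angle and adding a period. *)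
Lemma polar_coordinates (x y : R) : exists rho d, 0 <= rho /\ 0 <= d <= 2 * PI /\
  x = rho * sin d /\ y = rho * cos d.
Proof.
assert (Hpi := PI_RGT_0).
set (rho := sqrt (x ^ 2 + y ^ 2)); exists rho.
assert (E : rho * rho = x ^ 2 + y ^ 2) by (apply sqrt_sqrt; nra).
assert (Hr : 0 <= rho) by apply sqrt_pos.
destruct (Req_dec rho 0) as [Z|Z].
{ exists 0; rewrite Z in *; repeat split; nra. }
assert (P : 0 < rho) by lra.
assert (Y : -1 <= y / rho <= 1) by (split; [apply Rle_div_r | apply Rle_div_l]; nra).
assert (A := acos_bound (y / rho)).
assert (C : rho * cos (acos (y / rho)) = y) by (rewrite cos_acos by exact Y; field; lra).
assert (S : rho * sin (acos (y / rho)) = Rabs x).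
{ assert (T := sin2_cos2 (acos (y / rho))); unfold Rsqr in T.
  assert (0 <= sin (acos (y / rho))) by (apply sin_ge_0; lra).
  apply Rsqr_inj; [nra | apply Rabs_pos |].
  rewrite <- Rsqr_abs; unfold Rsqr.
  set (s := sin (acos (y / rho))) in *; set (c := cos (acos (y / rho))) in *.
  transitivity (rho * rho * (s * s + c * c) - (rho * c) * (rho * c)); [ring|].
  rewrite T, C, E; ring. }
destruct (Rle_dec 0 x) as [X|X].
- exists (acos (y / rho)); rewrite S, C, Rabs_pos_eq by exact X; repeat split; lra.
- exists (- acos (y / rho) + 2 * PI).
  assert (E1 : sin (- acos (y / rho) + 2 * PI) = - sin (acos (y / rho))).
  { rewrite sin_plus, sin_2PI, cos_2PI, sin_neg; ring. }
  assert (E2 : cos (- acos (y / rho) + 2 * PI) = cos (acos (y / rho))).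
  { rewrite cos_plus, sin_2PI, cos_2PI, cos_neg; ring. }
  rewrite E1, E2, C; rewrite Rabs_left in S by lra; repeat split; lra.
Qed.

Lemma heaviside_neg (theta0 z : R) : z < 0 -> heaviside theta0 z = 0.
Proof. intros H; unfold heaviside; destruct (total_order_T z 0) as [[?|?]|?]; lra. Qed.

Lemma heaviside_pos (theta0 z : R) : 0 < z -> heaviside theta0 z = 1.
Proof. intros H; unfold heaviside; destruct (total_order_T z 0) as [[?|?]|?]; lra. Qed.

Lemma heaviside_0 (theta0 : R) : heaviside theta0 0 = theta0.
Proof. unfold heaviside; destruct (total_order_T 0 0) as [[?|?]|?]; lra. Qed.

Lemma cos_lt_of_abs_lt (p x : R) : 0 <= p -> - PI <= x <= PI -> p < Rabs x -> cos x < cos p.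
Proof.
intros Hp Hx H; assert (Rabs x <= PI) by (apply Rabs_le; lra).
replace (cos x) with (cos (Rabs x)).
- apply cos_decreasing_1; lra.
- unfold Rabs; destruct (Rcase_abs x); [apply cos_neg | reflexivity].
Qed.

Lemma v_polar_integral (theta0 h rho t : R) : 0 < h -> 0 < rho ->
  exists l, is_RInt (fun x => v theta0 h (rho * sin x) (rho * cos x) t) (- PI) PI l /\
    Rabs l <= 1 / (4 * Rpower PI (3 / 2) * sqrt h) * (2 * PI ^ 2).
Proof.
intros Hh Hr; assert (Hpi := PI_RGT_0).
set (K := 1 / (4 * Rpower PI (3 / 2) * sqrt h)).
assert (HK : 0 < K).
{ apply Rdiv_lt_0_compat; [lra|].
  apply Rmult_lt_0_compat; [|now apply sqrt_lt_R0].
  apply Rmult_lt_0_compat; [lra | apply exp_pos]. }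
assert (Pos : 0 <= K * (2 * PI ^ 2)) by (apply Rmult_le_pos; nra).
destruct (Rlt_dec rho (Rabs t)) as [L|L].
{ exists 0; rewrite Rabs_R0; split; [|exact Pos].
  apply is_RInt_zero; [lra|]; intros x _; unfold v.
  rewrite heaviside_neg; [ring|].
  assert (B := COS_bound x); nra. }
set (p := acos (Rabs t / rho)).
assert (T := Rabs_pos t).
assert (T01 : 0 <= Rabs t / rho <= 1)
  by (split; [apply Rle_div_r | apply Rle_div_l]; lra).
assert (Cp : cos p = Rabs t / rho) by (apply cos_acos; lra).
assert (Et : Rabs t = rho * cos p) by (rewrite Cp; field; lra).
assert (Bp : 0 <= p <= PI) by apply acos_bound.
assert (Hp2 : p <= PI / 2).
{ destruct (Rle_dec p (PI / 2)) as [|F]; [assumption|].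
  assert (cos p < cos (PI / 2)) by (apply cos_decreasing_1; lra).
  rewrite cos_PI2 in *; lra. }
assert (Out : forall x, - PI <= x <= PI -> p < Rabs x ->
   v theta0 h (rho * sin x) (rho * cos x) t = 0).
{ intros x Hx H; unfold v; rewrite heaviside_neg; [ring|].
  assert (C := cos_lt_of_abs_lt p x ltac:(lra) Hx H); rewrite Et; nra. }
assert (Z1 : is_RInt (fun x => v theta0 h (rho * sin x) (rho * cos x) t) (- PI) (- p) 0).
{ apply is_RInt_zero; [lra|]; intros x Hx; apply Out; [lra|].
  rewrite Rabs_left by lra; lra. }
assert (Z2 : is_RInt (fun x => v theta0 h (rho * sin x) (rho * cos x) t) p PI 0).
{ apply is_RInt_zero; [lra|]; intros x Hx; apply Out; [lra|].
  rewrite Rabs_pos_eq by lra; lra. }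
assert (Mid : exists l, is_RInt (fun x => v theta0 h (rho * sin x) (rho * cos x) t) (- p) p l /\
    Rabs l <= K * (2 * PI ^ 2)).
(* For [p = 0], that is [rho = |t|], the cap shrinks to one angle and the middle interval is
   degenerate. *)
{ destruct (Req_dec p 0) as [P0|P0].
  { exists 0; rewrite Rabs_R0; split; [|exact Pos].
    apply is_RInt_zero; [lra|]; intros x Hx; lra. }
  assert (Hp : 0 < p <= PI / 2) by lra.
  assert (Ha : 0 <= 1 / h * (rho * sin p) ^ 2)
    by (apply Rmult_le_pos; [apply Rlt_le, Rdiv_lt_0_compat; lra | apply pow2_ge_0]).
  destruct (cap_laplace_average _ p Ha Hp) as [l [Hl Bl]].
  exists (- K * l); split.
  - apply is_RInt_ext with (2 := is_RInt_Rmult _ (- K) _ _ _ Hl).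
    rewrite Rmin_left, Rmax_right by lra; intros x Hx.
    unfold v; rewrite (w_polar h rho p x t) by lra.
    rewrite heaviside_pos; [fold K; eqR; ring|].
    assert (Ax : Rabs x < p) by (apply Rabs_def1; lra).
    assert (C : cos p < cos x).
    { replace (cos x) with (cos (Rabs x))
        by (unfold Rabs; destruct (Rcase_abs x); [apply cos_neg | reflexivity]).
      apply cos_decreasing_1; [apply Rabs_pos | lra | lra | lra | exact Ax]. }
    rewrite Et; nra.
  - rewrite Rabs_mult, Rabs_Ropp, (Rabs_pos_eq K) by lra.
    (* [4 * PI * p] is at most [2 * PI ^ 2] because [p <= PI / 2]. *)
    apply Rmult_le_compat_l; [lra|]; nra. }
destruct Mid as [l [Hl Bl]]; exists l; split; [|exact Bl].
assert (H := is_RInt_Chasles (V := R_NormedModule) _ _ _ _ _ _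
   (is_RInt_Chasles (V := R_NormedModule) _ _ _ _ _ _ Z1 Hl) Z2).
replace l with (0 + l + 0) by ring; exact H.
Qed.

Theorem mainTheorem2 (theta0 : R) (K : R * R * R -> Prop) (HK : compact_set K) :
  exists C h0 : R, 0 < C /\ 0 < h0 /\
    forall x y t h : R, K (x, y, t) -> 0 < h < h0 ->
      Rabs (V theta0 h x y t) <= C * Rpower h (- (1 / 2)).
Proof.
assert (Hpi := PI_RGT_0); assert (Rp : 0 < Rpower PI (3 / 2)) by apply exp_pos.
(* The part without [theta0] is [1 / (2 * PI)] times twice the bound of [v_polar_integral]; the part
   with [theta0] is the contribution of the point [x = y = t = 0]. *)
exists (1 / (4 * Rpower PI (3 / 2)) * (2 * PI * (1 + Rabs theta0))), 1.
assert (T0 := Rabs_pos theta0).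
split; [|split; [lra|]].
{ apply Rmult_lt_0_compat; [apply Rdiv_lt_0_compat; lra | nra]. }
intros x y t h _ [Hh _].
assert (Sh : 0 < sqrt h) by now apply sqrt_lt_R0.
replace (Rpower h (- (1 / 2))) with (/ sqrt h).
2:{ rewrite Rpower_Ropp; f_equal; rewrite <- Rpower_sqrt by exact Hh; f_equal; lra. }
set (k := 1 / (4 * Rpower PI (3 / 2) * sqrt h)).
replace (1 / (4 * Rpower PI (3 / 2)) * (2 * PI * (1 + Rabs theta0)) * / sqrt h)
  with (1 / (2 * PI) * (k * (2 * PI ^ 2) + k * (2 * PI ^ 2) + 2 * PI * (Rabs theta0 * (k * (2 * PI)))))
  by (unfold k; field; repeat split; lra).
assert (Hk : 0 < k).
{ apply Rdiv_lt_0_compat; [lra|]; apply Rmult_lt_0_compat; lra. }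
assert (Pos1 : 0 <= k * (2 * PI ^ 2)) by (apply Rmult_le_pos; nra).
assert (Pos2 : 0 <= Rabs theta0 * (k * (2 * PI)))
  by (apply Rmult_le_pos; [lra | apply Rmult_le_pos; lra]).
destruct (polar_coordinates x y) as [rho [d [Hr [Hd [-> ->]]]]].
assert (Main : exists l,
  is_RInt (fun a => v_rot theta0 a h (rho * sin d) (rho * cos d) t) (- PI) PI l /\
  Rabs l <= k * (2 * PI ^ 2) + 2 * PI * (Rabs theta0 * (k * (2 * PI)))).
(* Rotating by [a] adds [a] to the polar angle, so the average over rotations is an integral over a
   full period and the starting angle [d] drops out. *)
{ assert (Ext : forall a, v_rot theta0 a h (rho * sin d) (rho * cos d) t
      = v theta0 h (rho * sin (a + d)) (rho * cos (a + d)) t).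
  { intros a; unfold v_rot; rewrite sin_plus, cos_plus; f_equal; ring. }
  destruct (Req_dec rho 0) as [Z|Z].
  - subst rho; exists ((PI - - PI) * v theta0 h 0 0 t); split.
    + apply (is_RInt_ext (fun _ => v theta0 h 0 0 t)); [|apply is_RInt_Rconst].
      intros a _; rewrite Ext, !Rmult_0_l; reflexivity.
    + replace (PI - - PI) with (2 * PI) by ring.
      rewrite Rabs_mult, (Rabs_pos_eq (2 * PI)) by lra.
      apply Rle_trans with (2 * PI * (Rabs theta0 * (k * (2 * PI)))); [|lra].
      apply Rmult_le_compat_l; [lra|]; unfold v.
      destruct (Req_dec t 0) as [-> | Ht].
      * rewrite w_zero, Rabs_R0, Rminus_0_r, heaviside_0; fold k.
        rewrite Rabs_mult, Rabs_Ropp, (Rabs_pos_eq (k * (2 * PI))); [lra|].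
        apply Rmult_le_pos; lra.
      * rewrite heaviside_neg by (assert (A := Rabs_pos_lt t Ht); lra).
        rewrite Ropp_0, Rmult_0_l, Rabs_R0; exact Pos2.
  - destruct (v_polar_integral theta0 h rho t Hh) as [l [Hl Bl]]; [lra|].
    exists l; split; [|fold k in Bl; nra].
    apply (is_RInt_ext (fun a => v theta0 h (rho * sin (a + d)) (rho * cos (a + d)) t)).
    + intros a _; symmetry; apply Ext.
    + apply (is_RInt_shift_period (fun a => v theta0 h (rho * sin a) (rho * cos a) t));
        [exact Hd | | exact Hl].
      intros a; rewrite sin_plus, cos_plus, sin_2PI, cos_2PI; f_equal; ring. }
destruct Main as [l [Hl Bl]]; unfold V.
rewrite (is_RInt_unique (V := R_CompleteNormedModule) _ _ _ _ Hl).
rewrite Rabs_mult, (Rabs_pos_eq (1 / (2 * PI))) by (apply Rlt_le, Rdiv_lt_0_compat; lra).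
apply Rmult_le_compat_l; [apply Rlt_le, Rdiv_lt_0_compat; lra|]; lra.
Qed.
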